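(* Let $\Gamma$ be a discrete subgroup of $\mathrm{GL}_2(F_\infty)$ with $\det(\Gamma)\subset\mathcal{O}_\infty^\times$. Let $r\geqslant 1$, $k_1,\ldots,k_r\geqslant 1$, $k=\sum_{i=1}^r k_i$, $l\in\mathbb{Z}$, let $H$ be a subgroup of $\Gamma$ with $\det(h)^l=1$ for all $h\in H$, and let $a_1,b_1,\ldots,a_r,b_r\in\mathbb{P}^1(F_\infty)$ satisfy: (a) $a_i\neq b_i$ for all $i$; (b) $\{a_i,b_i\}\neq\{a_j,b_j\}$ for $i\neq j$; (c) $ha_i=a_i$ and $hb_i=b_i$ for all $h\in H$ and all $i$. For a vertex $v$ of $\mathcal{T}$ and $N\geqslant 0$ let $$S_N(v)=\{[\gamma]\in H\backslash\Gamma : d(\gamma v,[a_i\to b_i])\leqslant N\text{ for all }1\leqslant i\leqslant r\}.$$ Then the series $$f(z)=\sum_{[\gamma]\in H\backslash\Gamma}(\det\gamma)^l\prod_{i=1}^r u(z;\gamma^{-1}a_i,\gamma^{-1}b_i)^{k_i}$$ converges locally uniformly on $\Omega$ if and only if $S_N(v)$ is finite for some (equivalently, all) vertices $v$ of $\mathcal{T}$ and all $N\geqslant 0$. In this case, $f\colon\Omega\to\mathbb{C}_\infty$ is holomorphic, $P(z)=f(z)\,(\mathrm{d}z)^k$ is a holomorphic $k$-form on $\Omega$, and $|f(z)|\leqslant |z|_i^{-k}$ for all $z\in\Omega$.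
   Context: $q=p^e$ is an odd prime power, $F=\mathbb{F}_q(T)$, $\pi=1/T$, $F_\infty=\mathbb{F}_q((\pi))$ with ring of integers $\mathcal{O}_\infty=\mathbb{F}_q[[\pi]]$; $\mathbb{C}_\infty$ is the completion of an algebraic closure of $F_\infty$; $\mathrm{ord}$ is the valuation with $\mathrm{ord}(\pi)=1$, extended to $\mathbb{C}_\infty$, and $|x|=q^{-\mathrm{ord}(x)}$. The Drinfeld half-plane is $\Omega=\mathbb{C}_\infty\setminus F_\infty$ with its rigid analytic structure. $\mathrm{GL}_2(F_\infty)$ acts on $\Omega$ and $\mathbb{P}^1(F_\infty)$ by linear fractional transformations. For $z\in\Omega$, $|z|_i=\inf\{|z-x|:x\in F_\infty\}$. For distinct $a,b$, $u(z;a,b)=\frac{1}{z-b}-\frac{1}{z-a}$, with the convention $\frac1{z-\infty}=0$. Locally uniform convergence on $\Omega$ means uniform convergence (of the sum over the cosets) on each affinoid $U_m=\{z\in\Omega: |z|\leqslant q^m,\ |z|_i\geqslant q^{-m}\}$, $m\geqslant 0$; these form an admissible covering. Holomorphic means rigid analytic. $\mathcal{T}$ is the Bruhat–Tits tree of $\mathrm{PGL}_2(F_\infty)$: vertices are homothety classes $[L]$ of $\mathcal{O}_\infty$-lattices $L$ of rank two in the space $F_\infty^2$ of row vectors, two being adjacent if they have representatives with $\pi L\subset L'\subset L$ (strict inclusions). $\gamma\in\mathrm{GL}_2(F_\infty)$ acts by $\gamma[L]=[L\gamma^{-1}]$. Put $v_n=[\pi^n\mathcal{O}_\infty f_1+\mathcal{O}_\infty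 f_2]$, with $f_1,f_2$ the canonical basis. The ends of $\mathcal{T}$ are identified $\mathrm{GL}_2(F_\infty)$-equivariantly with $\mathbb{P}^1(F_\infty)$ so that the half-line $(v_n)_{n\geqslant0}$ represents $\infty$ and $(v_{-n})_{n\geqslant 0}$ represents $0$. For distinct $a,b\in\mathbb{P}^1(F_\infty)$, $[a\to b]$ is the doubly infinite geodesic of $\mathcal{T}$ from $a$ to $b$; $d$ is the path distance on $\mathcal{T}$. *)

(* Defs.v *)
From HB Require Import structures.
From mathcomp Require Import all_boot all_order all_algebra.
From mathcomp Require Import finmap zify ring.
From mathcomp Require Import all_classical all_reals ereal.
Set Implicit Arguments.
Unset Strict Implicit.
Unset Printing Implicit Defensive.
Import Order.TTheory GRing.Theory Num.Theory.
Local Open Scope classical_set_scope.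
Local Open Scope ring_scope.

(* Formal Laurent series K((pi)): x n is the coefficient of pi^n. *)
Record laurent (K : fieldType) := Laurent {
  lcoef :> int -> K;
  lcoef_bounded : exists N : int, forall n, n < N -> lcoef n = 0 }.

HB.instance Definition _ (K : fieldType) := gen_eqMixin (laurent K).
HB.instance Definition _ (K : fieldType) := gen_choiceMixin (laurent K).

Section LaurentField.
Variable K : fieldType.
Implicit Types (x y z : laurent K) (M N n : int) (k : nat).

Lemma laurent_ext x y : (forall n, x n = y n) -> x = y.
Proof.
case: x y => [f hf] [g hg] /= fg; have E : f = g by apply/funext.
by subst g; congr Laurent; apply: Prop_irrelevance.
Qed.

Definition lmul_coef (f g : int -> K) n : K :=
  \sum_(i \in [set: int]) f i * g (n - i).

Lemma lmul_coefE f g M N k :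
    (forall n, n < M -> f n = 0) -> (forall n, n < N -> g n = 0) ->
  lmul_coef f g (M + N + k%:Z)
    = \sum_(i < k.+1) f (M + i%:Z) * g (N + (k - i)%N%:Z).
Proof.
move=> hf hg; rewrite /lmul_coef.
rewrite (fsbigE [seq M + i%:Z | i <- iota 0 k.+1]).
- rewrite big_map -[iota 0 k.+1]/(index_iota 0 k.+1) big_mkord.
  apply: eq_big => [i|i _]; first by rewrite in_setT.
  congr (_ * g _); have := ltn_ord i; lia.
- by rewrite map_inj_uniq ?iota_uniq// => i j; lia.
- by [].
- move=> i _ hi; case: (ltP i M) => [/hf->|hMi]; first by rewrite mul0r.
  case: (ltP (M + N + k%:Z - i) N) => [/hg->|hNi]; first by rewrite mulr0.
  case/negP: hi; apply/mapP; exists (absz (i - M)%R); last by lia.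
  by rewrite mem_iota; lia.
Qed.

Lemma lmul_coef0 f g M N n :
    (forall n, n < M -> f n = 0) -> (forall n, n < N -> g n = 0) ->
  n < M + N -> lmul_coef f g n = 0.
Proof.
move=> hf hg hn; rewrite /lmul_coef fsbig1// => i _.
case: (ltP i M) => [/hf->|hMi]; first by rewrite mul0r.
by rewrite hg ?mulr0//; lia.
Qed.

Fact laurent_zero_subproof : exists N, forall n, n < N -> (fun=> 0 : K) n = 0.
Proof. by exists 0. Qed.
Definition laurent_zero := Laurent laurent_zero_subproof.

Fact laurent_opp_subproof x :
  exists N, forall n, n < N -> (fun n => - x n) n = 0.
Proof. by have [N hN] := lcoef_bounded x; exists N => n /hN->; rewrite oppr0. Qed.
Definition laurent_opp x := Laurent (laurent_opp_subproof x).

Fact laurent_add_subproof x y :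
  exists N, forall n, n < N -> (fun n => x n + y n) n = 0.
Proof.
have [M hM] := lcoef_bounded x; have [N hN] := lcoef_bounded y.
by exists (Num.min M N) => n hn; rewrite hM ?hN ?addr0//; lia.
Qed.
Definition laurent_add x y := Laurent (laurent_add_subproof x y).

Fact laurent_addA : associative laurent_add.
Proof. by move=> x y z; apply: laurent_ext => n /=; rewrite addrA. Qed.
Fact laurent_addC : commutative laurent_add.
Proof. by move=> x y; apply: laurent_ext => n /=; rewrite addrC. Qed.
Fact laurent_add0 : left_id laurent_zero laurent_add.
Proof. by move=> x; apply: laurent_ext => n /=; rewrite add0r. Qed.
Fact laurent_addN : left_inverse laurent_zero laurent_opp laurent_add.
Proof. by move=> x; apply: laurent_ext => n /=; rewrite addNr. Qed.

HB.instance Definition _ := GRing.isZmodule.Build (laurent K)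
  laurent_addA laurent_addC laurent_add0 laurent_addN.

Fact laurent_one_subproof :
  exists N, forall n, n < N -> (fun n => (n == 0)%:R : K) n = 0.
Proof. by exists 0 => n hn; case: eqP => // h; lia. Qed.
Definition laurent_one := Laurent laurent_one_subproof.

Fact laurent_mul_subproof x y :
  exists N, forall n, n < N -> lmul_coef x y n = 0.
Proof.
have [M hM] := lcoef_bounded x; have [N hN] := lcoef_bounded y.
by exists (M + N) => n; apply: lmul_coef0.
Qed.
Definition laurent_mul x y := Laurent (laurent_mul_subproof x y).

Let P k (f : int -> K) M := \poly_(i < k) f (M + i%:Z).

Lemma lmul_poly f g M N k m :
    (forall n, n < M -> f n = 0) -> (forall n, n < N -> g n = 0) ->
  (k < m)%N -> lmul_coef f g (M + N + k%:Z) = (P m f M * P m g N)`_k.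
Proof.
move=> hf hg km; rewrite (lmul_coefE _ hf hg) coefM.
apply: eq_bigr => i _; rewrite !coef_poly !ifT//; have := ltn_ord i; lia.
Qed.

Fact laurent_mulC : commutative laurent_mul.
Proof.
move=> x y; apply: laurent_ext => n /=.
have [M hM] := lcoef_bounded x; have [N hN] := lcoef_bounded y.
have [hn|hn] := ltP n (M + N).
  by rewrite (lmul_coef0 hM hN)// (lmul_coef0 hN hM)// addrC.
have -> : n = M + N + (absz (n - (M + N))%R)%:Z by lia.
by rewrite (lmul_poly hM hN (ltnSn _)) mulrC -(lmul_poly hN hM) 1?[N + M]addrC.
Qed.

Fact laurent_mulA : associative laurent_mul.
Proof.
move=> x y z; apply: laurent_ext => n /=.
have [M hM] := lcoef_bounded x; have [N hN] := lcoef_bounded y.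
have [Q hQ] := lcoef_bounded z.
have hxy i : i < M + N -> lmul_coef x y i = 0 by apply: lmul_coef0.
have hyz i : i < N + Q -> lmul_coef y z i = 0 by apply: lmul_coef0.
have [hn|hn] := ltP n (M + N + Q).
  by rewrite (lmul_coef0 hxy hQ)// (lmul_coef0 hM hyz)// addrA.
have -> : n = M + N + Q + (absz (n - (M + N + Q))%R)%:Z by lia.
set k := absz _; transitivity ((P k.+1 x M * P k.+1 y N * P k.+1 z Q)`_k).
  rewrite -[M + N + Q]addrA (lmul_coefE _ hM hyz) -mulrA coefM.
  apply: eq_bigr => i _; rewrite coef_poly ltn_ord.
  by rewrite (lmul_poly hN hQ (m := k.+1))//; lia.
rewrite (lmul_coefE _ hxy hQ) coefM.
apply: eq_bigr => i _; rewrite (lmul_poly hM hN (ltn_ord i)) coef_poly ifT//; lia.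
Qed.

Fact laurent_mul1 : left_id laurent_one laurent_mul.
Proof.
move=> x; apply: laurent_ext => n /=; rewrite /lmul_coef (fsbigE [:: 0])//=.
  by rewrite big_mkcond big_seq1 in_setT mul1r subr0.
by move=> i _; rewrite inE => /negbTE->; rewrite mul0r.
Qed.

Fact laurent_mulDl : left_distributive laurent_mul laurent_add.
Proof.
move=> x y z; apply: laurent_ext => n /=.
have [M0 hM0] := lcoef_bounded x; have [N0 hN0] := lcoef_bounded y.
have [Q hQ] := lcoef_bounded z; pose M := Num.min M0 N0.
have hM i : i < M -> x i = 0 by move=> hi; apply: hM0; lia.
have hN i : i < M -> y i = 0 by move=> hi; apply: hN0; lia.
have hMN i : i < M -> x i + y i = 0 by move=> hi; rewrite hM ?hN ?addr0.
have [hn|hn] := ltP n (M + Q).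
  by rewrite (lmul_coef0 hM hQ)// (lmul_coef0 hN hQ)// (lmul_coef0 hMN hQ) ?addr0.
have -> : n = M + Q + (absz (n - (M + Q))%R)%:Z by lia.
rewrite (lmul_coefE _ hM hQ) (lmul_coefE _ hN hQ) (lmul_coefE _ hMN hQ).
by rewrite -big_split; apply: eq_bigr => i _; rewrite mulrDl.
Qed.

Fact laurent_1_neq0 : laurent_one != 0 :> laurent K.
Proof.
by apply/eqP => /(congr1 (fun x : laurent K => x 0))/eqP/=; rewrite oner_eq0.
Qed.

HB.instance Definition _ := GRing.Zmodule_isComNzRing.Build (laurent K)
  laurent_mulA laurent_mulC laurent_mul1 laurent_mulDl laurent_1_neq0.

Lemma laurent_ord_ex x : x != 0 ->
  exists n, x n != 0 /\ forall m, m < n -> x m = 0.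
Proof.
move=> x0; have [N hN] := lcoef_bounded x.
have [n0 hn0] : exists n, x n != 0.
  apply: contrapT => h; case/eqP: x0; apply: laurent_ext => n.
  by apply: contrapT => /eqP hn; apply: h; exists n.
have hNn : N <= n0 by rewrite leNgt; apply: contraNN hn0 => /hN->.
have ex : exists k, x (N + k%:Z) != 0.
  by exists (absz (n0 - N)%R); have -> : N + (absz (n0 - N)%R)%:Z = n0 by lia.
case: (ex_minnP ex) => k hk kmin; exists (N + k%:Z); split=> // m hm.
have [/hN//|hNm] := ltP m N.
apply: contrapT => /eqP hxm; have := kmin (absz (m - N)%R).
have -> : N + (absz (m - N)%R)%:Z = m by lia.
by move=> /(_ hxm); lia.
Qed.

(* coefficients of the inverse of a power series with coefficients a *)
Let invs (a : nat -> K) := fix invs k : seq K :=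
  if k is k'.+1 then
    let s := invs k' in
    rcons s ((a 0%N)^-1 * ((k' == 0%N)%:R - \sum_(i < k') s`_i * a (k' - i)%N))
  else [::].

Let invs_size a k : size (invs a k) = k.
Proof. by elim: k => //= k IH; rewrite size_rcons IH. Qed.

Let invs_nth a k i : (i < k)%N -> (invs a k)`_i = (invs a i.+1)`_i.
Proof.
elim: k => // k IH; rewrite ltnS leq_eqVlt => /predU1P[->//|ik].
by rewrite [LHS]/= nth_rcons invs_size ik IH.
Qed.

Let invs_conv a k : a 0%N != 0 ->
  \sum_(i < k.+1) (invs a i.+1)`_i * a (k - i)%N = (k == 0%N)%:R.
Proof.
move=> a0; rewrite big_ord_recr /= nth_rcons invs_size ltnn eqxx subnn.
rewrite [X in _ + X]mulrC mulVKf//.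
rewrite (eq_bigr (fun i : 'I_k => (invs a k)`_i * a (k - i)%N)).
  by rewrite addrC subrK.
by move=> i _; rewrite (invs_nth a (ltn_ord i)).
Qed.

Lemma laurent_inv_ex x : x != 0 -> exists y : laurent K, y * x = 1.
Proof.
move=> /laurent_ord_ex[N [xN hN]]; pose a i := x (N + i%:Z).
have a0 : a 0%N != 0 by rewrite /a addr0.
pose g n := if n < - N then 0 else let i := (absz (n + N)%R) in (invs a i.+1)`_i.
have hg : exists M, forall n, n < M -> g n = 0.
  by exists (- N) => n hn; rewrite /g hn.
exists (Laurent hg); apply: laurent_ext => n /=.
have hgN m : m < - N -> g m = 0 by move=> hm; rewrite /g hm.
have [hn|hn] := ltP n 0.
  by rewrite (lmul_coef0 hgN hN) ?addNr//; case: eqP => // h; lia.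
have -> : n = - N + N + (absz n)%:Z by lia.
rewrite (lmul_coefE _ hgN hN) -[RHS]/((_ == 0)%:R).
transitivity ((absz n == 0%N)%:R : K); last by congr (_%:R); congr nat_of_bool; lia.
rewrite -(invs_conv _ a0); apply: eq_bigr => i _; congr (_ * _).
rewrite /g ifF; last by lia.
by have -> : (absz (- N + i%:Z + N)%R) = i by lia.
Qed.

Definition laurent_inv x : laurent K := xget 0 [set y | y * x = 1].

Fact laurent_mulV x : x != 0 -> laurent_inv x * x = 1.
Proof.
by move=> /laurent_inv_ex[y yx]; rewrite /laurent_inv; case: xgetP => // /(_ y).
Qed.

Fact laurent_inv0 : laurent_inv 0 = 0.
Proof.
rewrite /laurent_inv; case: xgetP => // y _ /= /eqP.
by rewrite mulr0 eq_sym oner_eq0.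
Qed.

HB.instance Definition _ := GRing.ComNzRing_isField.Build (laurent K)
  laurent_mulV laurent_inv0.

End LaurentField.

Section LocalField.
Variable Fq : finFieldType.
Local Notation F := (laurent Fq).

Fact laurent_pi_subproof :
  exists N : int, forall n, n < N -> (fun n => (n == 1)%:R : Fq) n = 0.
Proof. by exists 1 => n; case: eqP => // ->; rewrite ltxx. Qed.
Definition laurent_pi : F := Laurent laurent_pi_subproof.

(* junk value 0 at x = 0 *)
Definition laurent_ord (x : F) : int :=
  xget 0 [set n | x n != 0 /\ forall m, m < n -> x m = 0].

Definition laurent_abs (R : realType) (x : F) : R :=
  if x == 0 then 0 else #|Fq|%:R ^ (- laurent_ord x).

Definition Oinf : set F := [set x | forall n : int, n < 0 -> x n = 0].

Definition Oinf_units : set F :=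
  [set x | [/\ x != 0, Oinf x & Oinf x^-1]].

End LocalField.

(* A completion of an algebraic closure of F_q((pi)). Such an object is unique
   up to isometric isomorphism; statements about C_infty quantify over all of
   them. The absolute value is the one with |x| = q^(-ord x). *)
Record Cinfty (R : realType) (Fq : finFieldType) := {
  Fbar : closedFieldType;
  Fbar_of : {rmorphism laurent Fq -> Fbar};
  Fbar_algebraic : forall x : Fbar, algebraicOver Fbar_of x;
  Cinf :> fieldType;
  Cabs : Cinf -> R;
  Cabs_ge0 : forall x, 0 <= Cabs x;
  Cabs_eq0 : forall x, Cabs x = 0 <-> x = 0;
  CabsM : forall x y, Cabs (x * y) = Cabs x * Cabs y;
  Cabs_ultra : forall x y, Cabs (x + y) <= Num.max (Cabs x) (Cabs y);
  Cinf_of : {rmorphism Fbar -> Cinf};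
  Cabs_extends : forall x : laurent Fq,
    Cabs (Cinf_of (Fbar_of x)) = laurent_abs R x;
  Fbar_dense : forall (z : Cinf) (e : R), 0 < e ->
    exists x : Fbar, Cabs (z - Cinf_of x) < e;
  Cinf_complete : forall w : nat -> Cinf,
    (forall e : R, 0 < e -> exists N, forall m n, (N <= m)%N -> (N <= n)%N ->
      Cabs (w m - w n) < e) ->
    exists l, forall e : R, 0 < e -> exists N, forall n, (N <= n)%N ->
      Cabs (w n - l) < e }.

Section HalfPlane.
Variables (R : realType) (Fq : finFieldType) (CC : Cinfty R Fq).
Local Notation F := (laurent Fq).
Local Notation C := (Cinf CC).
Implicit Types (z : C) (f : C -> C).

Definition F_to_C (x : F) : C := Cinf_of CC (Fbar_of CC x).

Definition Omega : set C := ~` range F_to_C.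

Definition imabs z : R := inf [set Cabs (z - F_to_C x) | x in [set: F]].

Definition U_ (m : nat) : set C :=
  [set z | [/\ Omega z, Cabs z <= #|Fq|%:R ^+ m & #|Fq|%:R ^- m <= imabs z]].

(* Uniform convergence on every U_m of the net of finite partial sums. *)
Definition loc_unif_sum (I : choiceType) (t : I -> C -> C) f :=
  forall (m : nat) (e : R), 0 < e ->
  exists A0 : {fset I}, forall A : {fset I}, (A0 `<=` A)%fset ->
  forall z, U_ m z -> Cabs (\sum_(i <- A) t i z - f z) < e.

(* The affinoid algebra of the affinoid U of P^1 is the completion, for the
   supremum norm on U, of the algebra of rational functions without poles
   in U. *)
Definition affinoid_fun (U : set C) f :=
  forall e : R, 0 < e -> exists p d : {poly C},
    forall z, U z -> d.[z] != 0 /\ Cabs (f z - p.[z] / d.[z]) < e.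

(* The U_m form an admissible covering of Omega by affinoids. *)
Definition holomorphic f := forall m, affinoid_fun (U_ m) f.

(* A k-form is a section of the k-th tensor power of the cotangent line bundle,
   viewed as the function (z, v) |-> w z v, homogeneous of degree k in the
   tangent vector v at z; (dz)^k is (z, v) |-> v ^+ k. *)
Definition dz_pow (k : nat) : C -> C := fun v => v ^+ k.

Definition holomorphic_form (k : nat) (w : C -> C -> C) :=
  exists2 g, holomorphic g &
    forall z, Omega z -> forall v, w z v = g z * dz_pow k v.

(* P^1(F) is option F, with None the point at infinity. *)
Definition inv_sub z (a : option F) : C :=
  if a is Some x then (z - F_to_C x)^-1 else 0.

Definition u_ z (a b : option F) : C := inv_sub z b - inv_sub z a.

End HalfPlane.

Section Groups.
Variable Fq : finFieldType.
Local Notation F := (laurent Fq).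
Implicit Types (G H : set 'M[F]_2) (g h : 'M[F]_2).

Definition GL2_subgroup G :=
  [/\ forall g, G g -> g \in unitmx, G 1%:M,
      forall g h, G g -> G h -> G (g *m h) & forall g, G g -> G (invmx g)].

(* The topology of GL_2(F_infty) is the one induced by the matrix entries:
   inversion is continuous for it. *)
Definition GL2_discrete (R : realType) G :=
  forall g, G g -> exists2 e : R, 0 < e &
    forall h, G h -> (forall i j, laurent_abs R (h i j - g i j) < e) -> h = g.

Definition mobius g (x : option F) : option F :=
  match x with
  | Some t => let d := g 1 0 * t + g 1 1 in
              if d == 0 then None else Some ((g 0 0 * t + g 0 1) / d)
  | None => if g 1 0 == 0 then None else Some (g 0 0 / g 1 0)
  end.

Definition coset H g : set 'M[F]_2 := [set h *m g | h in H].

Definition cosets H G : set (set 'M[F]_2) := [set coset H g | g in G].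

Definition coset_repr H G (X : cosets H G) : 'M[F]_2 := xget 1%:M (val X).

End Groups.

Section Tree.
Variables (R : realType) (Fq : finFieldType).
Local Notation F := (laurent Fq).
Local Notation pi := (laurent_pi Fq).
Implicit Types (L : set 'rV[F]_2) (v w : set (set 'rV[F]_2)) (g : 'M[F]_2).
Implicit Types (a b : option F).

(* The O_infty-span of the rows of some g in GL_2(F_infty). *)
Definition lattice L := exists2 g : 'M[F]_2, g \in unitmx &
  L = [set c *m g | c in [set c : 'rV[F]_2 | forall j, Oinf (c 0 j)]].

Definition homothety_class L : set (set 'rV[F]_2) :=
  [set [set c *: x | x in L] | c in [set c : F | c != 0]].

Definition vertex v := exists2 L, lattice L & v = homothety_class L.

Definition adjacent v w :=
  [/\ vertex v, vertex w & exists L L', [/\ v L, w L',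
    [set pi *: x | x in L] `<` L' & L' `<` L]].

Definition vertex_act g v : set (set 'rV[F]_2) :=
  [set [set x *m invmx g | x in L] | L in v].

Definition std_vertex (n : int) : set (set 'rV[F]_2) :=
  homothety_class [set x | exists c d, [/\ Oinf c, Oinf d &
    x = (pi ^ n * c) *: delta_mx 0 0 + d *: delta_mx 0 1]].

(* Path distance, with value +oo in the absence of a path. *)
Definition tree_dist v w : \bar R :=
  ereal_inf [set ((size s)%:R)%:E | s in
    [set s | path (fun x y => `[< adjacent x y >]) v s /\ last v s = w]].

Definition tree_dist_set v (A : set (set (set 'rV[F]_2))) : \bar R :=
  ereal_inf [set tree_dist v w | w in A].

Definition half_line (s : nat -> set (set 'rV[F]_2)) :=
  injective s /\ forall n, adjacent (s n) (s n.+1).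

Definition same_end (s t : nat -> set (set 'rV[F]_2)) :=
  exists m n, forall k, s (m + k)%N = t (n + k)%N.

(* The end of the half-line s corresponds to a in P^1(F_infty). As GL_2 acts
   transitively on P^1, the equivariant identification is determined by its
   value on the end of (v_n)_(n >= 0), which is infinity. Since w = (0 1; 1 0)
   satisfies w v_n = v_(-n) and w oo = 0, the end of (v_(-n))_(n >= 0) is
   then 0. *)
Definition represents (s : nat -> set (set 'rV[F]_2)) a :=
  half_line s /\ exists g, [/\ g \in unitmx, mobius g None = a &
    same_end s (fun n => vertex_act g (std_vertex n))].

Definition geodesic_line (s : int -> set (set 'rV[F]_2)) a b :=
  [/\ forall m n : int, tree_dist (s m) (s n) = (`|m - n|%:~R)%:E,
      represents (fun n => s (- n%:Z)) a & represents (fun n => s n%:Z) b].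

(* The vertices of [a -> b]; the parametrization is unique up to shift. *)
Definition geodesic a b : set (set (set 'rV[F]_2)) :=
  [set v | exists2 s, geodesic_line s a b & range s v].

End Tree.

Section Series.
Variables (R : realType) (Fq : finFieldType) (CC : Cinfty R Fq).
Local Notation F := (laurent Fq).
Variables (G H : set 'M[F]_2) (r : nat) (k : 'I_r -> nat) (l : int).
Variables (a b : 'I_r -> option F).

Definition S_ (N : nat) (v : set (set 'rV[F]_2)) : set (set 'M[F]_2) :=
  [set coset H g | g in [set g | G g /\ forall i,
    (tree_dist_set R (vertex_act g v) (geodesic R (a i) (b i)) <= N%:R%:E)%E]].

Definition term (g : 'M[F]_2) (z : CC) : CC :=
  F_to_C CC (\det g ^ l) *
  \prod_(i < r) u_ z (mobius (invmx g) (a i)) (mobius (invmx g) (b i)) ^+ k i.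

(* When det(h)^l = 1 and h fixes all a_i and b_i for every h in H, the value
   does not depend on the representative of X. *)
Definition coset_term (X : cosets H G) (z : CC) : CC := term (coset_repr X) z.

End Series.

(* Main.v *)
Require Import Defs.
From HB Require Import structures.
From mathcomp Require Import all_boot all_order all_algebra.
From mathcomp Require Import finmap all_classical all_reals ereal.
From mathcomp Require Import zify ring.
Set Implicit Arguments.
Unset Strict Implicit.
Unset Printing Implicit Defensive.
Import Order.TTheory GRing.Theory Num.Theory.
Local Open Scope classical_set_scope.
Local Open Scope ring_scope.

(* Represent a point a of P^1(F) by the row vector x_a vanishing at it, namely
   (1, -a), or (0, 1) for infinity. A lattice L has a norm N_L on row vectors, and
   the distance from [L] to [a -> b] is -log_q of
     phi_L(a, b) = |x_a wedge x_b| / (covol(L) N_L(x_a) N_L(x_b)).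
   A point z of Omega has the norm N_z(x) = |x_0 z + x_1|, and
     |u(z; a, b)| = |x_a wedge x_b| / (N_z(x_a) N_z(x_b)).
   On U_m the norms N_z are comparable, uniformly in z, to that of the standard
   lattice; hence |u(z; gamma^-1 a, gamma^-1 b)| is, up to constants depending only
   on m, q^-(the distance from gamma v_0 to [a -> b]). By the ultrametric
   inequality the series converges uniformly on U_m if and only if its terms tend
   uniformly to 0, which is the finiteness of the sets S_N. *)

(** The obstacle on the tree side is that a line from [a] to [b] is prescribed only by its mutual
    distances and its two ends, so an arbitrary such line has to be located. Two functions on
    vertices do this: [Phi], which is [q^-d] for the distance [d] to the apartment, and [Beta],
    which records the position along it. An edge changes exactly one of them, by a factor [q] or
    [q^-1]. This bounds path lengths from below; explicit chains of lattices bound them from above.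

    On the analytic side, a coset lies outside [S_N] as soon as one of the [r] geodesics is far from
    [gamma v], so a single small factor has to control the whole product. The other factors are at
    most [|z|_i^-1], hence at most [q^m] on [U_m]. Conversely, inside [S_N] all factors are bounded
    below, and one point of Omega already bounds the number of cosets. The norm of a point of [U_m]
    and the standard norm compare with a loss of [q^m] in one direction and of [q^(2m)] in the
    other; [phi] contains two norms, whence the constants [q^(2m)] and [q^(4m)]. *)

(** * The absolute value on Laurent series *)

Section AbsoluteValue.
Variables (R : realType) (Fq : finFieldType).
Local Notation F := (laurent Fq).
Local Notation pi := (laurent_pi Fq).
Local Notation q := (#|Fq|%:R : R).
Local Notation abs := (@laurent_abs Fq R).
Implicit Types (x y : F) (m n : int).

Lemma q_gt1 : 1 < q.
Proof. by rewrite ltr1n card_finNzRing_gt1. Qed.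

Lemma q_gt0 : 0 < q.
Proof. exact: lt_trans q_gt1. Qed.

Lemma qz_gt0 n : 0 < q ^ n.
Proof. by rewrite exprz_gt0 ?q_gt0. Qed.

Lemma qzD m n : q ^ (m + n) = q ^ m * q ^ n.
Proof. by rewrite expfzDr// gt_eqF ?q_gt0. Qed.

Lemma qz_le m n : (q ^ m <= q ^ n) = (m <= n).
Proof. by rewrite ler_eXz2l ?q_gt1. Qed.

Lemma qz_lt m n : (q ^ m < q ^ n) = (m < n).
Proof. by rewrite ltr_eXz2l ?q_gt1. Qed.

Lemma qz_inj : injective (fun n => q ^ n).
Proof. by apply: ieexprIz; rewrite ?q_gt0 ?gt_eqF ?q_gt1. Qed.

Lemma expq_unbounded (x : R) : exists n : nat, x < q ^+ n.
Proof.
exists (Num.bound x); apply: lt_le_trans (upper_nthrootP (leqnn _)) _.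
by rewrite lerXn2r ?nnegrE// ler_nat card_finNzRing_gt1.
Qed.

Lemma laurent_ordP x : x != 0 ->
  x (laurent_ord x) != 0 /\ forall m, m < laurent_ord x -> x m = 0.
Proof.
move=> /laurent_ord_ex[n hn]; rewrite /laurent_ord.
by case: xgetP => [//|/(_ n)].
Qed.

Lemma laurent_abs0 : abs 0 = 0.
Proof. by rewrite /laurent_abs eqxx. Qed.

Lemma laurent_absE x : x != 0 -> abs x = q ^ (- laurent_ord x).
Proof. by rewrite /laurent_abs => /negbTE->. Qed.

Lemma laurent_abs_ge0 x : 0 <= abs x.
Proof. by rewrite /laurent_abs; case: eqP => // _; rewrite ltW ?qz_gt0. Qed.

Lemma laurent_abs_eq0 x : (abs x == 0) = (x == 0).
Proof.
by rewrite /laurent_abs; case: (eqVneq x 0) => _; [exact: eqxx | exact/gt_eqF/qz_gt0].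
Qed.

Lemma laurent_abs_gt0 x : (0 < abs x) = (x != 0).
Proof. by rewrite lt_def laurent_abs_eq0 laurent_abs_ge0 andbT. Qed.

(** Covers [x = 0] as well, so that ultrametric estimates can be read off coefficient by
    coefficient. *)
Lemma laurent_abs_le x n : abs x <= q ^ (- n) <-> forall m, m < n -> x m = 0.
Proof.
have [->|x0] := eqVneq x 0; first by rewrite laurent_abs0 ltW ?qz_gt0.
have [xo xlt] := laurent_ordP x0.
rewrite laurent_absE// qz_le lerN2; split=> [h m mn|h].
  by apply: xlt; apply: lt_le_trans h.
by rewrite leNgt; apply: contra_neqN xo => /h.
Qed.

Lemma laurent_abs_lt x n : abs x < q ^ (- n) <-> forall m, m <= n -> x m = 0.
Proof.
have -> : abs x < q ^ (- n) = (abs x <= q ^ (- (n + 1))).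
  have [->|x0] := eqVneq x 0; first by rewrite laurent_abs0 qz_gt0 ltW ?qz_gt0.
  by rewrite laurent_absE// qz_lt qz_le; lia.
by rewrite laurent_abs_le; split=> h m mn; apply: h; lia.
Qed.

Lemma OinfP x : Oinf x <-> abs x <= 1.
Proof. by have := laurent_abs_le x 0; rewrite oppr0 expr0z => ->. Qed.

Lemma laurent_absM x y : abs (x * y) = abs x * abs y.
Proof.
have [->|x0] := eqVneq x 0; first by rewrite mul0r laurent_abs0 mul0r.
have [->|y0] := eqVneq y 0; first by rewrite mulr0 laurent_abs0 mulr0.
have [xo xlt] := laurent_ordP x0; have [yo ylt] := laurent_ordP y0.
(* At this index the convolution has a single term, the product of the two leading coefficients. *)
have h : (x * y) (laurent_ord x + laurent_ord y) != 0.
  rewrite -[X in (x * y) X]addr0 [(x * y) _](@lmul_coefE _ x y _ _ 0%N xlt ylt).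
  by rewrite big_ord1 !addr0 mulf_neq0.
rewrite !laurent_absE ?mulf_neq0// -qzD -opprD; congr (_ ^ (- _)).
have [zo zlt] := laurent_ordP (mulf_neq0 x0 y0).
apply/eqP; rewrite eq_le !leNgt; apply/andP; split.
  by apply: contra_neqN h => /zlt.
by apply: contra_neqN zo => /(lmul_coef0 xlt ylt).
Qed.

Lemma laurent_abs1 : abs 1 = 1.
Proof.
have := laurent_absM 1 1; rewrite mulr1 => /esym/eqP.
by rewrite -[X in _ == X]mulr1 (inj_eq (mulfI _)) ?laurent_abs_eq0 ?oner_eq0// => /eqP.
Qed.

Lemma laurent_absV x : abs x^-1 = (abs x)^-1.
Proof.
have [->|x0] := eqVneq x 0; first by rewrite invr0 laurent_abs0 invr0.
have x1 : abs x != 0 by rewrite laurent_abs_eq0.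
by apply: (mulfI x1); rewrite -laurent_absM !mulfV// laurent_abs1.
Qed.

Lemma laurent_absN x : abs (- x) = abs x.
Proof.
have h : abs (-1) = 1.
  apply/eqP; rewrite -(@pexpr_eq1 _ _ 2)// ?laurent_abs_ge0//.
  by rewrite expr2 -laurent_absM mulrNN mulr1 laurent_abs1.
by rewrite -mulN1r laurent_absM h mul1r.
Qed.

Lemma laurent_absX x n : abs (x ^ n) = abs x ^ n.
Proof.
have hn (m : nat) : abs (x ^+ m) = abs x ^+ m.
  by elim: m => [|m IH]; rewrite ?expr0 ?laurent_abs1// !exprS laurent_absM IH.
case: n => m; first exact: hn.
by rewrite NegzE -!exprnN laurent_absV hn.
Qed.

Lemma laurent_absD x y : abs (x + y) <= Num.max (abs x) (abs y).
Proof.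
wlog xy : x y / abs x <= abs y => [h|].
  have /orP[/h//|/h] := le_total (abs x) (abs y).
  by rewrite addrC maxC.
rewrite (max_idPr xy); have [y0|y0] := eqVneq y 0.
  by move: xy; rewrite y0 addr0.
move: xy; rewrite (laurent_absE y0) !laurent_abs_le => xlt m mn.
by rewrite /= xlt// (laurent_ordP y0).2// addr0.
Qed.

Lemma laurent_absD_le x y (e : R) : abs x <= e -> abs y <= e -> abs (x + y) <= e.
Proof. by move=> hx hy; apply: le_trans (laurent_absD _ _) _; rewrite ge_max hx. Qed.

Lemma laurent_abs_val x : x != 0 -> exists n, abs x = q ^ n.
Proof. by move=> x0; exists (- laurent_ord x); rewrite laurent_absE. Qed.

Lemma laurent_abs_pi : abs pi = q^-1.
Proof.
have p1 : pi 1 = 1 by [].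
have p0 : pi != 0 by apply: contra_eq_neq p1 => ->; rewrite eq_sym oner_eq0.
rewrite laurent_absE//; have [h1 h2] := laurent_ordP p0.
suff -> : laurent_ord pi = 1 by [].
have [//|ne] := eqVneq (laurent_ord pi) 1.
by move: h1; rewrite /= (negbTE ne) eqxx.
Qed.

Lemma laurent_pi_neq0 : pi != 0.
Proof. by rewrite -laurent_abs_gt0 laurent_abs_pi invr_gt0 q_gt0. Qed.

Lemma laurent_abs_piX n : abs (pi ^ n) = q ^ (- n).
Proof. by rewrite laurent_absX laurent_abs_pi exprz_inv. Qed.

End AbsoluteValue.

(** * Row vectors, the wedge product and lattices in rank two *)

Section Rank2.
Variables (R : realType) (Fq : finFieldType).
Local Notation F := (laurent Fq).
Local Notation pi := (laurent_pi Fq).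
Local Notation q := (#|Fq|%:R : R).
Local Notation abs := (@laurent_abs Fq R).
Implicit Types (x y : 'rV[F]_2) (g M : 'M[F]_2) (c : F).

Lemma ord2P (P : 'I_2 -> Prop) : P 0 -> P 1 -> forall i, P i.
Proof.
move=> P0 P1 [[|[|//]] i]; first by rewrite (_ : Ordinal i = 0)//; apply: val_inj.
by rewrite (_ : Ordinal i = 1)//; apply: val_inj.
Qed.

Lemma lift00 : lift 0 0 = 1 :> 'I_2. Proof. exact: val_inj. Qed.

Lemma lift10 : lift 1 0 = 0 :> 'I_2. Proof. exact: val_inj. Qed.

Lemma mulmx2E m n (A : 'M[F]_(m, 2)) (B : 'M[F]_(2, n)) i j :
  (A *m B) i j = A i 0 * B 0 j + A i 1 * B 1 j.
Proof. by rewrite mxE !big_ord_recl big_ord0 addr0 -[ord0]/(0 : 'I_2) lift00. Qed.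

Lemma det2E M : \det M = M 0 0 * M 1 1 - M 0 1 * M 1 0.
Proof.
rewrite (expand_det_row _ 0) 2!big_ord_recl big_ord0 addr0 lift00.
rewrite /cofactor !det_mx11 !mxE lift00 lift10 !add0n expr0 expr1 mul1r.
by rewrite mulN1r mulrN.
Qed.

Definition wedge x y : F := x 0 0 * y 0 1 - x 0 1 * y 0 0.

Lemma wedgeM x y M : wedge (x *m M) (y *m M) = wedge x y * \det M.
Proof. by rewrite /wedge !mulmx2E det2E; ring. Qed.

Lemma wedgeZl c x y : wedge (c *: x) y = c * wedge x y.
Proof. by rewrite /wedge !mxE; ring. Qed.

Lemma wedgeZr c x y : wedge x (c *: y) = c * wedge x y.
Proof. by rewrite /wedge !mxE; ring. Qed.

Lemma wedgeC x y : wedge y x = - wedge x y.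
Proof. by rewrite /wedge; ring. Qed.

Definition vnorm x : R := Num.max (abs (x 0 0)) (abs (x 0 1)).

Lemma vnorm_le x (e : R) : vnorm x <= e <-> forall j, abs (x 0 j) <= e.
Proof.
rewrite /vnorm ge_max; split=> [/andP[h0 h1]|h]; last by rewrite !h.
exact: ord2P.
Qed.

Lemma vnorm_ge x j : abs (x 0 j) <= vnorm x.
Proof. by move: j; apply/vnorm_le. Qed.

Lemma vnorm_ge0 x : 0 <= vnorm x.
Proof. exact: le_trans (laurent_abs_ge0 _ _) (vnorm_ge x 0). Qed.

Lemma vnormZ c x : vnorm (c *: x) = abs c * vnorm x.
Proof. by rewrite /vnorm !mxE !laurent_absM maxr_pMr ?laurent_abs_ge0. Qed.

Lemma vnorm_attained x : exists j, vnorm x = abs (x 0 j).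
Proof.
by rewrite /vnorm; case: leP => _; [exists 1 | exists 0].
Qed.

Lemma vnorm_val x : x != 0 -> exists n : int, vnorm x = q ^ n.
Proof.
move=> x0; have [j hj] := vnorm_attained x.
suff /(laurent_abs_val R)[n hn] : x 0 j != 0 by exists n; rewrite hj.
apply: contraNN x0 => /eqP xj; apply/eqP/rowP => i; rewrite mxE.
apply/eqP; rewrite -(laurent_abs_eq0 R) eq_le laurent_abs_ge0 andbT.
by apply: le_trans (vnorm_ge x i) _; rewrite hj xj laurent_abs0.
Qed.

Lemma vnorm_gt0 x : x != 0 -> 0 < vnorm x.
Proof. by move=> /vnorm_val[n ->]; apply: qz_gt0. Qed.

Lemma vnorm_mulmx x M (e : R) : (forall i j, abs (M i j) <= e) ->
  vnorm (x *m M) <= vnorm x * e.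
Proof.
move=> hM; apply/vnorm_le => j; rewrite mulmx2E.
by apply: laurent_absD_le; rewrite laurent_absM ler_pM ?laurent_abs_ge0 ?vnorm_ge.
Qed.

Lemma abs_wedge x y : abs (wedge x y) <= vnorm x * vnorm y.
Proof.
by apply: laurent_absD_le; rewrite ?laurent_absN laurent_absM ler_pM
  ?laurent_abs_ge0 ?vnorm_ge.
Qed.

Definition integral M := forall i j, abs (M i j) <= 1.

Lemma vnorm_integral x M : integral M -> vnorm (x *m M) <= vnorm x.
Proof. by move=> /(vnorm_mulmx x); rewrite mulr1. Qed.

Lemma integral_det M : integral M -> abs (\det M) <= 1.
Proof.
move=> hM; rewrite det2E; apply: laurent_absD_le; rewrite ?laurent_absN laurent_absM.
  by apply: mulr_ile1; rewrite ?laurent_abs_ge0.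
by apply: mulr_ile1; rewrite ?laurent_abs_ge0.
Qed.

(** The adjugate of an integral matrix is integral, so only the division by the determinant can
    enlarge the inverse. *)
Lemma abs_invmx M i j : M \in unitmx -> integral M ->
  abs (invmx M i j) <= (abs (\det M))^-1.
Proof.
move=> Mu hM; rewrite /invmx Mu !mxE /cofactor det_mx11 !mxE.
rewrite laurent_absM laurent_absV ler_piMr ?invr_ge0 ?laurent_abs_ge0//.
by rewrite laurent_absM exprnP laurent_absX laurent_absN laurent_abs1 exp1rz mul1r.
Qed.

Lemma det_neq0 M : M \in unitmx -> \det M != 0.
Proof. by rewrite unitmxE unitfE. Qed.

Lemma abs_det_gt0 M : M \in unitmx -> 0 < abs (\det M).
Proof. by move=> /det_neq0; rewrite laurent_abs_gt0. Qed.

Lemma integral_invmx M : integral M -> abs (\det M) = 1 ->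
  M \in unitmx /\ integral (invmx M).
Proof.
move=> hM d1; have Mu : M \in unitmx.
  by rewrite unitmxE unitfE -(laurent_abs_eq0 R) d1 oner_eq0.
by split=> // i j; apply: le_trans (abs_invmx _ _ Mu hM) _; rewrite d1 invr1.
Qed.

Definition lat g : set 'rV[F]_2 :=
  [set c *m g | c in [set c : 'rV[F]_2 | forall j, Oinf (c 0 j)]].

Lemma latP g x : g \in unitmx -> lat g x <-> vnorm (x *m invmx g) <= 1.
Proof.
move=> gu; rewrite vnorm_le; split=> [[c hc <-] j|h].
  by rewrite mulmxK//; apply/OinfP/hc.
by exists (x *m invmx g); [move=> j; apply/(OinfP R)/h | rewrite mulmxKV].
Qed.

(** The rows of [g *m invmx g'] are the coordinates, in the basis given by [g'], of generators of
    [lat g]. *)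
Lemma lat_sub g g' : g \in unitmx -> g' \in unitmx ->
  lat g `<=` lat g' <-> integral (g *m invmx g').
Proof.
move=> gu gu'; split=> [h i j|h x].
  have : lat g (row i g).
    apply/latP => //; rewrite -row_mul mulmxV// vnorm_le => k.
    by rewrite !mxE; case: eqP; rewrite ?laurent_abs1 ?laurent_abs0.
  by move=> /h /latP; rewrite -row_mul => /(_ gu')/vnorm_le/(_ j); rewrite mxE.
move=> /(latP _ gu) hx; apply/(latP _ gu').
rewrite -(mulmxKV gu x) -[X in vnorm X <= _]mulmxA.
exact: le_trans (vnorm_integral _ h) hx.
Qed.

Lemma lat_scale c g : [set c *: x | x in lat g] = lat (c *: g).
Proof.
apply/seteqP; split=> x.
  by case=> _ [d hd <-] <-; exists d => //; rewrite scalemxAr.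
by case=> d hd <-; exists (d *m g); [exists d | rewrite scalemxAr].
Qed.

Lemma scale_unitmx c g : c != 0 -> g \in unitmx -> c *: g \in unitmx.
Proof. by move=> c0 gu; rewrite unitmxZ ?unitfE. Qed.

Lemma invmx_scale c g : c != 0 -> g \in unitmx ->
  invmx (c *: g) = c^-1 *: invmx g.
Proof. by move=> c0 gu; rewrite invmxZ// scale_unitmx. Qed.

End Rank2.

(* The least [abs c] such that [x] lies in [c] times the lattice [lat g]. *)
HB.lock Definition lnorm (R : realType) (Fq : finFieldType) (g : 'M[laurent Fq]_2)
  (x : 'rV[laurent Fq]_2) : R := vnorm R (x *m invmx g).
Arguments lnorm {R Fq} g x.
Local Notation lnormE := lnorm.unlock.

(** * The norm attached to a lattice *)

Section LatticeGauge.
Variables (R : realType) (Fq : finFieldType).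
Local Notation F := (laurent Fq).
Local Notation pi := (laurent_pi Fq).
Local Notation q := (#|Fq|%:R : R).
Local Notation abs := (@laurent_abs Fq R).
Local Notation vnorm := (@vnorm R Fq).
Local Notation lnorm := (@lnorm R Fq).
Local Notation integral := (@integral R Fq).
Implicit Types (x y : 'rV[F]_2) (g M : 'M[F]_2) (c : F).

Lemma lnormZ g c x : lnorm g (c *: x) = abs c * lnorm g x.
Proof. by rewrite lnormE -scalemxAl vnormZ. Qed.

Lemma mulmx_neq0 g x : g \in unitmx -> x != 0 -> x *m g != 0.
Proof.
by move=> gu; apply: contraNN => /eqP h; rewrite -(mulmxK gu x) h mul0mx.
Qed.

Lemma lnorm_val g x : g \in unitmx -> x != 0 -> exists n : int, lnorm g x = q ^ n.
Proof.
by move=> gu x0; rewrite lnormE; apply/vnorm_val/mulmx_neq0; rewrite ?unitmx_inv.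
Qed.

Lemma lnorm_gt0 g x : g \in unitmx -> x != 0 -> 0 < lnorm g x.
Proof. by move=> gu /(lnorm_val gu)[n ->]; apply: qz_gt0. Qed.

Lemma lnorm_scale g c x : c != 0 -> g \in unitmx ->
  lnorm (c *: g) x = (abs c)^-1 * lnorm g x.
Proof.
by move=> c0 gu; rewrite lnormE invmx_scale// -scalemxAr vnormZ laurent_absV.
Qed.

(** [h *m invmx g] spans the image of [lat h] under the tree action of [g]; this moves [g] from the
    lattice to the vectors. *)
Lemma lnorm_act g h x : g \in unitmx -> h \in unitmx ->
  lnorm (h *m invmx g) x = lnorm h (x *m g).
Proof.
move=> gu hu; rewrite lnormE -mulmxA; congr (vnorm (_ *m _)).
have hgu : h *m invmx g \in unitmx by rewrite unitmx_mul hu unitmx_inv.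
apply: (can_inj (mulmxK hgu)); rewrite mulVmx// mulmxA -[g *m _ *m _]mulmxA mulVmx//.
by rewrite mulmx1 mulmxV.
Qed.

(** [lat (M *m g)] lies between [\det M] times [lat g] and [lat g], and a smaller lattice has a
    larger norm. *)
Lemma lnorm_mul g M x : g \in unitmx -> M \in unitmx -> integral M ->
  lnorm g x <= lnorm (M *m g) x <= (abs (\det M))^-1 * lnorm g x.
Proof.
move=> gu Mu hM.
have h : x *m invmx g = x *m invmx (M *m g) *m M.
  have Mgu : M *m g \in unitmx by rewrite unitmx_mul Mu.
  apply: (can_inj (mulmxK gu)); rewrite -!mulmxA mulVmx// mulVmx//.
apply/andP; split; first by rewrite lnormE h vnorm_integral.
have -> : lnorm (M *m g) x = vnorm (x *m invmx g *m invmx M).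
  by rewrite lnormE h mulmxK.
by rewrite lnormE mulrC; apply: vnorm_mulmx => i j; apply: abs_invmx.
Qed.

End LatticeGauge.

(** * Vertices as classes of invertible matrices *)

Section Vertices.
Variables (R : realType) (Fq : finFieldType).
Local Notation F := (laurent Fq).
Local Notation pi := (laurent_pi Fq).
Local Notation q := (#|Fq|%:R : R).
Local Notation abs := (@laurent_abs Fq R).
Local Notation lnorm := (@lnorm R Fq).
Local Notation integral := (@integral R Fq).
Implicit Types (x y : 'rV[F]_2) (g M : 'M[F]_2) (c : F).
Implicit Types (v w : set (set 'rV[F]_2)).

Definition vmx g := homothety_class (lat g).

Lemma vertexP v : vertex v <-> exists2 g, g \in unitmx & v = vmx g.
Proof.
split=> [[L [g gu ->] ->]|[g gu ->]]; first by exists g.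
by exists (lat g) => //; exists g.
Qed.

Lemma vmx_vertex g : g \in unitmx -> vertex (vmx g).
Proof. by move=> gu; apply/vertexP; exists g. Qed.

Lemma vmxP g L : vmx g L <-> exists2 c, c != 0 & L = lat (c *: g).
Proof.
by split=> [[c c0 <-]|[c c0 ->]]; exists c => //; rewrite lat_scale.
Qed.

Lemma vmx_scale c g : c != 0 -> vmx (c *: g) = vmx g.
Proof.
move=> c0; apply/seteqP; split=> L /vmxP[d d0 ->]; apply/vmxP.
  by exists (d * c); rewrite ?mulf_neq0 ?scalerA.
by exists (d / c); rewrite ?mulf_neq0 ?invr_eq0// scalerA divfK.
Qed.

Lemma vmx_mem g L : g \in unitmx -> vmx g L ->
  exists h, [/\ h \in unitmx, L = lat h & vmx g = vmx h].
Proof.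
by move=> gu /vmxP[c c0 ->]; exists (c *: g); rewrite scale_unitmx ?vmx_scale.
Qed.

Lemma invmx_div g g' : g \in unitmx -> g' \in unitmx ->
  invmx (g' *m invmx g) = g *m invmx g'.
Proof.
move=> gu gu'; have u : g' *m invmx g \in unitmx by rewrite unitmx_mul gu' unitmx_inv.
by apply: (can_inj (mulmxK u)); rewrite (mulVmx u) mulmxA (mulmxKV gu') (mulmxV gu).
Qed.

Lemma abs_det_div g g' : abs (\det (g' *m invmx g)) = abs (\det g') / abs (\det g).
Proof. by rewrite det_mulmx det_inv laurent_absM laurent_absV. Qed.

Lemma lat_eq_mul g M : g \in unitmx -> integral M -> abs (\det M) = 1 ->
  lat (M *m g) = lat g.
Proof.
move=> gu hM d1; have [Mu hMi] := integral_invmx hM d1.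
have Mgu : M *m g \in unitmx by rewrite unitmx_mul Mu.
apply/seteqP; split; apply/(lat_sub R) => //; first by rewrite (mulmxK gu).
by rewrite -(invmx_div gu Mgu) (mulmxK gu).
Qed.

(** Both transition matrices are integral and their determinants are inverse to each other, so both
    have absolute value 1. *)
Lemma lat_eqP g g' : g \in unitmx -> g' \in unitmx -> lat g = lat g' ->
  abs (\det g) = abs (\det g') /\ lnorm g =1 lnorm g'.
Proof.
move=> gu gu' e; have h : integral (g *m invmx g') by apply/lat_sub; rewrite // e.
have h' : integral (g' *m invmx g) by apply/lat_sub; rewrite // e.
have d1 : abs (\det (g *m invmx g')) = 1.
  apply/eqP; rewrite eq_le integral_det//= abs_det_div ler_pdivlMr ?abs_det_gt0//.
  have := integral_det h'; rewrite abs_det_div ler_pdivrMr ?abs_det_gt0//.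
  by rewrite !mul1r.
split.
  have := d1; rewrite abs_det_div => /divr1_eq; exact.
move=> x; have u : g *m invmx g' \in unitmx by rewrite unitmx_mul gu unitmx_inv.
have := lnorm_mul x gu' u h; rewrite (mulmxKV gu') d1 invr1 mul1r => /andP[h1 h2].
by apply: le_anti; apply/andP; split; [exact: h2 | exact: h1].
Qed.

Lemma vmx_eqP g g' : g \in unitmx -> g' \in unitmx -> vmx g = vmx g' ->
  exists2 c, c != 0 & lat g = lat (c *: g').
Proof.
move=> gu gu' e; have : vmx g (lat g) by apply/vmxP; exists 1; rewrite ?oner_eq0 ?scale1r.
by rewrite e => /vmxP.
Qed.

End Vertices.

(* [q ^- d] for [d] the distance from the vertex of [g] to the apartment whose
   ends are the lines spanned by [x] and [y]. *)
HB.lock Definition phi (R : realType) (Fq : finFieldType) (g : 'M[laurent Fq]_2)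
    (x y : 'rV[laurent Fq]_2) : R :=
  laurent_abs R (wedge x y) / (laurent_abs R (\det g) * lnorm g x * lnorm g y).
Arguments phi {R Fq} g x y.

(* [q ^ b] for [b] the difference of the Busemann functions of these ends. *)
HB.lock Definition beta (R : realType) (Fq : finFieldType) (g : 'M[laurent Fq]_2)
    (x y : 'rV[laurent Fq]_2) : R := lnorm g x / lnorm g y.
Arguments beta {R Fq} g x y.

(** The default [1%:M] keeps the representative invertible for every set [v], which makes [Phi] and
    [Beta] positive throughout. *)
Definition vrep (Fq : finFieldType) (v : set (set 'rV[laurent Fq]_2)) : 'M_2 :=
  xget 1%:M [set g | g \in unitmx /\ v = vmx g].

HB.lock Definition Phi (R : realType) (Fq : finFieldType)
  (v : set (set 'rV[laurent Fq]_2)) x y : R := phi (vrep v) x y.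
Arguments Phi {R Fq} v x y.

HB.lock Definition Beta (R : realType) (Fq : finFieldType)
  (v : set (set 'rV[laurent Fq]_2)) x y : R := beta (vrep v) x y.
Arguments Beta {R Fq} v x y.

(** * The invariants of a vertex relative to two lines, and their change along edges *)

Section Invariants.
Variables (R : realType) (Fq : finFieldType).
Local Notation F := (laurent Fq).
Local Notation pi := (laurent_pi Fq).
Local Notation q := (#|Fq|%:R : R).
Local Notation abs := (@laurent_abs Fq R).
Local Notation lnorm := (@lnorm R Fq).
Local Notation phi := (@phi R Fq).
Local Notation beta := (@beta R Fq).
Local Notation Phi := (@Phi R Fq).
Local Notation Beta := (@Beta R Fq).
Local Notation integral := (@integral R Fq).
Implicit Types (x y : 'rV[F]_2) (g M : 'M[F]_2) (c : F).
Implicit Types (v w : set (set 'rV[F]_2)).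

Lemma wedge_neq0 x y : wedge x y != 0 -> x != 0 /\ y != 0.
Proof.
by move=> h; split; apply: contraNN h => /eqP->; rewrite /wedge !mxE; apply/eqP; ring.
Qed.

(** A homothety by [c] multiplies the covolume by [|c|^2] and each norm by [|c|^-1]; these factors
    cancel in both quotients. *)
Lemma phi_beta_vmx g g' x y : g \in unitmx -> g' \in unitmx -> vmx g = vmx g' ->
  phi g x y = phi g' x y /\ beta g x y = beta g' x y.
Proof.
move=> gu gu' /(vmx_eqP gu gu')[c c0 /(lat_eqP R gu (scale_unitmx c0 gu'))[e1 e2]].
have ca : abs c != 0 by rewrite laurent_abs_eq0.
rewrite phi.unlock beta.unlock !e2 e1 !lnorm_scale// detZ laurent_absM expr2 laurent_absM.
split; last by rewrite -mulf_div divff ?invr_eq0// mul1r.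
congr (_ / _); rewrite -[RHS]mul1r -(divff (mulf_neq0 ca ca)) invfM; ring.
Qed.

Lemma vrep_unit v : vrep v \in unitmx.
Proof. by rewrite /vrep; case: xgetP => [g _ []//|_]; rewrite unitmx1. Qed.

Lemma vrepK g : g \in unitmx -> vmx (vrep (vmx g)) = vmx g.
Proof. by move=> gu; rewrite /vrep; case: xgetP => [h _ []//|/(_ g)/not_andP[]]. Qed.

Lemma Phi_vmx g x y : g \in unitmx -> Phi (vmx g) x y = phi g x y.
Proof.
move=> gu; rewrite Phi.unlock.
exact: (phi_beta_vmx _ _ (vrep_unit _) gu (vrepK gu)).1.
Qed.

Lemma Beta_vmx g x y : g \in unitmx -> Beta (vmx g) x y = beta g x y.
Proof.
move=> gu; rewrite Beta.unlock.
exact: (phi_beta_vmx _ _ (vrep_unit _) gu (vrepK gu)).2.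
Qed.

(** The two strict inclusions put [abs (\det M)] strictly between [q^-2] and [1], and it is a power
    of [q]. Conversely, this determinant makes [pi *: invmx M] integral. *)
Lemma adjacentP v w : adjacent v w <-> exists g M,
  [/\ g \in unitmx, integral M, abs (\det M) = q^-1, v = vmx g & w = vmx (M *m g)].
Proof.
have q0 := q_gt0 R Fq; have q1 := q_gt1 R Fq; have pi0 := laurent_pi_neq0 R Fq.
have qV2 : q^-1 != 0 by rewrite invr_eq0 gt_eqF.
split=> [[/vertexP[g0 g0u v_] /vertexP[g0' g0u' w_] [L [L' []]]]|].
  rewrite {}v_ {}w_ => /(vmx_mem g0u)[g [gu -> ->]] /(vmx_mem g0u')[g' [gu' -> ->]].
  rewrite lat_scale => -[pi_sub pi_nsub] [sub nsub].
  have pgu := scale_unitmx pi0 gu.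
  have hM : integral (g' *m invmx g) by apply/lat_sub.
  have hK : integral (pi *: g *m invmx g') by apply/lat_sub.
  have Mu : g' *m invmx g \in unitmx by rewrite unitmx_mul gu' unitmx_inv.
  exists g, (g' *m invmx g); rewrite (mulmxKV gu); split=> //.
  have [n hn] := laurent_abs_val R (det_neq0 Mu).
  have n0 : n <= 0 by rewrite -(qz_le R Fq) -hn expr0z integral_det.
  have n_neq0 : n != 0.
    apply/eqP => n_eq0; move: hn; rewrite n_eq0 expr0z => /(integral_invmx hM)[_].
    by rewrite invmx_div// => /(lat_sub _ gu gu').
  have dK : abs (\det (pi *: g *m invmx g')) = q ^ (- n - 2).
    rewrite abs_det_div detZ expr2 !laurent_absM laurent_abs_pi -mulrA.
    rewrite -[abs (\det g) / _]invf_div.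
    rewrite -abs_det_div hn invr_expz -exprN1 -!qzD; congr (_ ^ _); clear; lia.
  have n2 : - 2 <= n.
    by have := integral_det hK; rewrite dK -(expr0z q) qz_le; clear; lia.
  have n_neq2 : n != - 2.
    apply/eqP => n_eq2; move: dK; rewrite n_eq2 opprK subrr expr0z.
    move=> /(integral_invmx hK)[_]; rewrite invmx_div// => /(lat_sub _ gu' pgu) h.
    by apply: pi_nsub.
  by rewrite hn; have -> : n = -1 by clear -n0 n_neq0 n2 n_neq2; lia.
move=> [g [M [gu hM dM -> ->]]]; have Mu : M \in unitmx.
  by rewrite unitmxE unitfE -(laurent_abs_eq0 R) dM.
have Mgu : M *m g \in unitmx by rewrite unitmx_mul Mu.
have pgu := scale_unitmx pi0 gu.
have dMg : abs (\det (M *m g)) = q^-1 * abs (\det g).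
  by rewrite det_mulmx laurent_absM dM.
split; [exact: vmx_vertex|exact: vmx_vertex|].
exists (lat g), (lat (M *m g)); split.
- by apply/vmxP; exists 1; rewrite ?oner_eq0 ?scale1r.
- by apply/vmxP; exists 1; rewrite ?oner_eq0 ?scale1r.
- rewrite lat_scale; split.
    apply/(lat_sub R) => // i j.
    rewrite -scalemxAl -(invmx_div gu Mgu) (mulmxK gu) mxE laurent_absM laurent_abs_pi.
    rewrite mulrC ler_pdivrMr// mul1r; apply: le_trans (abs_invmx _ _ Mu hM) _.
    by rewrite dM invrK.
  move=> /(lat_sub R Mgu pgu)/integral_det; rewrite abs_det_div dMg detZ.
  rewrite expr2 !laurent_absM laurent_abs_pi ler_pdivrMr; last first.
    by rewrite !mulr_gt0 ?invr_gt0 ?abs_det_gt0.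
  by rewrite mul1r ler_pM2r ?abs_det_gt0// ler_pMr ?invr_gt0// invf_ge1 ?leNgt ?q1.
split; first by apply/(lat_sub R) => //; rewrite mulmxK.
move=> /(lat_sub R gu Mgu)/integral_det; rewrite abs_det_div dMg.
rewrite ler_pdivrMr ?mulr_gt0 ?invr_gt0 ?abs_det_gt0// mul1r.
by rewrite ler_pMl ?abs_det_gt0// invf_ge1 ?leNgt ?q1.
Qed.

(** [lnorm_mul] leaves the range from [1] to [q] for the ratio, and norms of nonzero vectors are
    powers of [q]. *)
Lemma lnorm_step g M x : g \in unitmx -> x != 0 -> integral M ->
  abs (\det M) = q^-1 ->
  lnorm (M *m g) x = lnorm g x \/ lnorm (M *m g) x = q * lnorm g x.
Proof.
move=> gu x0 hM dM; have Mu : M \in unitmx.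
  by rewrite unitmxE unitfE -(laurent_abs_eq0 R) dM invr_eq0 gt_eqF ?q_gt0.
have := lnorm_mul x gu Mu hM; rewrite dM invrK.
have [m ->] := lnorm_val R gu x0; have Mgu : M *m g \in unitmx by rewrite unitmx_mul Mu.
have [n ->] := lnorm_val R Mgu x0; rewrite -[q in _ <= q * _]expr1z -qzD !qz_le => h.
have [->|nm] := eqVneq n m; first by left.
by right; have -> : n = 1 + m by lia; rewrite qzD expr1z.
Qed.

Lemma Beta_gt0 v x y : wedge x y != 0 -> 0 < Beta v x y.
Proof.
move=> /wedge_neq0[x0 y0].
by rewrite Beta.unlock beta.unlock divr_gt0 ?lnorm_gt0 ?vrep_unit.
Qed.

Lemma Phi_gt0 v x y : wedge x y != 0 -> 0 < Phi v x y.
Proof.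
move=> h; have [x0 y0] := wedge_neq0 h.
rewrite Phi.unlock phi.unlock divr_gt0 ?mulr_gt0 ?lnorm_gt0 ?abs_det_gt0 ?vrep_unit//.
by rewrite laurent_abs_gt0.
Qed.

(** Each of the two norms stays or grows by [q]. If both stay, the edge leads towards the apartment;
    if both grow, away from it; in either case [Beta] is fixed. If just one grows, [Phi] is fixed
    and [Beta] moves by [q] or [q^-1]. *)
Lemma adjacent_Phi_Beta v w x y : wedge x y != 0 -> adjacent v w ->
  [/\ Phi w x y <= q * Phi v x y, Beta w x y <= q * Beta v x y
    & Beta w x y = q * Beta v x y -> Phi w x y = Phi v x y].
Proof.
move=> xy /adjacentP[g [M [gu hM dM -> ->]]].
have q0 := q_gt0 R Fq; have q1 := q_gt1 R Fq; have [x0 y0] := wedge_neq0 xy.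
have Mu : M \in unitmx.
  by rewrite unitmxE unitfE -(laurent_abs_eq0 R) dM invr_eq0 gt_eqF.
have Mgu : M *m g \in unitmx by rewrite unitmx_mul Mu.
rewrite !(Phi_vmx _ _ gu) !(Phi_vmx _ _ Mgu) !(Beta_vmx _ _ gu) !(Beta_vmx _ _ Mgu).
rewrite phi.unlock beta.unlock det_mulmx laurent_absM dM.
have := abs_det_gt0 R gu; have := lnorm_gt0 R gu x0; have := lnorm_gt0 R gu y0.
have := xy; rewrite -(laurent_abs_gt0 R).
case: (lnorm_step gu x0 hM dM) => ->; case: (lnorm_step gu y0 hM dM) => ->.
all: move: (abs (\det g)) (lnorm g x) (lnorm g y) (abs (wedge x y)) => D X Y W.
all: move=> W0 Y0 X0 D0.
all: have WD : 0 < W / (D * X * Y) by rewrite divr_gt0 ?mulr_gt0.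
all: have XY : 0 < X / Y by rewrite divr_gt0.
all: move: q q0 q1 => p p0 p1.
- have -> : W / (p^-1 * D * X * Y) = p * (W / (D * X * Y)) by field; rewrite !gt_eqF.
  split=> //; first by rewrite ler_peMl ?ltW.
  (* [Beta] is fixed in this case, so the premise of the third clause amounts to [p = 1]. *)
  rewrite -[X in X = _]mul1r => /(mulIf (lt0r_neq0 XY)) p_1.
  by rewrite -p_1 mul1r.
- have -> : W / (p^-1 * D * X * (p * Y)) = W / (D * X * Y) by field; rewrite !gt_eqF.
  have -> : X / (p * Y) = p^-1 * (X / Y) by field; rewrite !gt_eqF.
  split=> //; first by rewrite ler_peMl ?ltW.
  by rewrite ler_pM2r// (le_trans _ (ltW p1))// invf_le1// ltW.
- have -> : W / (p^-1 * D * (p * X) * Y) = W / (D * X * Y) by field; rewrite !gt_eqF.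
  split=> //; first by rewrite ler_peMl ?ltW.
  by rewrite mulrA.
have -> : W / (p^-1 * D * (p * X) * (p * Y)) = p^-1 * (W / (D * X * Y)).
  by field; rewrite !gt_eqF.
have -> : p * X / (p * Y) = X / Y by field; rewrite !gt_eqF.
split.
- by rewrite ler_pM2r// (le_trans _ (ltW p1))// invf_le1// ltW.
- by rewrite ler_peMl ?ltW.
- rewrite -[X in X = _]mul1r => /(mulIf (lt0r_neq0 XY)) p_1.
  by rewrite -p_1 invr1 mul1r.
Qed.

(** The extremal growth of [Beta] over the whole path forces the factor [q] at every edge, and such
    edges fix [Phi]. *)
Lemma path_Phi_Beta v s x y : wedge x y != 0 ->
  path (fun v w => `[< adjacent v w >]) v s ->
  [/\ Phi (last v s) x y <= q ^+ size s * Phi v x y,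
      Beta (last v s) x y <= q ^+ size s * Beta v x y
    & Beta (last v s) x y = q ^+ size s * Beta v x y ->
      Phi (last v s) x y = Phi v x y].
Proof.
move=> xy; have q0 := q_gt0 R Fq.
elim: s v => [|w s IH] v /=; first by rewrite expr0 !mul1r.
move=> /andP[/asboolP /(adjacent_Phi_Beta xy)[h1 h2 h3] /IH[k1 k2 k3]]; split.
- by apply: le_trans k1 _; rewrite exprSr -mulrA ler_pM2l ?exprn_gt0.
- by apply: le_trans k2 _; rewrite exprSr -mulrA ler_pM2l ?exprn_gt0.
move=> e; have e2 : Beta w x y = q * Beta v x y.
  apply/eqP; rewrite eq_le h2 /= -(ler_pM2l (exprn_gt0 (size s) q0)) mulrA -exprSr.
  by rewrite -e.
by rewrite k3 ?h3// e2 mulrA -exprSr.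
Qed.

End Invariants.

(** * Walks and apartments *)

Section Apartments.
Variables (R : realType) (Fq : finFieldType).
Local Notation F := (laurent Fq).
Local Notation pi := (laurent_pi Fq).
Local Notation q := (#|Fq|%:R : R).
Local Notation abs := (@laurent_abs Fq R).
Local Notation lnorm := (@lnorm R Fq).
Local Notation phi := (@phi R Fq).
Local Notation beta := (@beta R Fq).
Local Notation Phi := (@Phi R Fq).
Local Notation Beta := (@Beta R Fq).
Local Notation integral := (@integral R Fq).
Implicit Types (x y : 'rV[F]_2) (g M : 'M[F]_2) (c : F) (m n : int) (k : nat).
Implicit Types (v w : set (set 'rV[F]_2)) (a b : option F).

Lemma adjacent_sym v w : adjacent v w -> adjacent w v.
Proof.
move=> /(adjacentP R)[g [M [gu hM dM -> ->]]]; apply/(adjacentP R).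
have Mu : M \in unitmx.
  by rewrite unitmxE unitfE -(laurent_abs_eq0 R) dM invr_eq0 gt_eqF ?q_gt0.
(* From [pi L < L' < L] one gets [pi L' < pi L < L']: the neighbour of [L'] is the homothetic copy
   [pi L]. *)
exists (M *m g), (pi *: invmx M); rewrite unitmx_mul Mu; split=> // [i j||].
- rewrite mxE laurent_absM laurent_abs_pi mulrC ler_pdivrMr ?q_gt0// mul1r.
  by apply: le_trans (abs_invmx _ _ Mu hM) _; rewrite dM invrK.
- rewrite detZ det_inv expr2 !laurent_absM laurent_absV laurent_abs_pi dM.
  by rewrite invrK -mulrA mulVf ?mulr1// gt_eqF ?q_gt0.
- rewrite mulmxA -scalemxAl (mulVmx Mu) -scalemxAl mul1mx.
  by rewrite vmx_scale ?(laurent_pi_neq0 R).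
Qed.

Definition walk v w (n : nat) := exists s,
  [/\ path (fun v w => `[< adjacent v w >]) v s, last v s = w & size s = n].

Lemma walk_seq (f : nat -> set (set 'rV[F]_2)) k :
  (forall i, adjacent (f i) (f i.+1)) -> walk (f 0%N) (f k) k.
Proof.
move=> hf; elim: k => [|k [s [ps ls ss]]]; first by exists [::].
exists (rcons s (f k.+1)).
by rewrite rcons_path ps last_rcons size_rcons ss ls; split=> //; apply/asboolP.
Qed.

Lemma walk_sym v w k : walk v w k -> walk w v k.
Proof.
case=> s [ps ls ss]; exists (rev (belast v s)); split.
- rewrite -ls rev_path; apply: sub_path ps => x y /= /asboolP h.
  exact/asboolP/adjacent_sym.
- by case: s ps ls ss => [|x s] //= _ _ _; rewrite rev_cons last_rcons.
- by rewrite size_rev size_belast.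
Qed.

Lemma tree_dist_le v w k : walk v w k -> (tree_dist R v w <= (k%:R)%:E)%E.
Proof. by case=> s [ps ls <-]; apply: ereal_inf_lbound; exists s. Qed.

Lemma tree_dist_leP v w (n : nat) : (tree_dist R v w < (n.+1%:R)%:E)%E ->
  exists2 m : nat, (m <= n)%N & walk v w m.
Proof.
move=> /ereal_inf_lt[_ [s [ps ls] <-]]; rewrite lte_fin ltr_nat ltnS => h.
by exists (size s) => //; exists s.
Qed.

Lemma walk_Phi_Beta v w (n : nat) x y : wedge x y != 0 -> walk v w n ->
  [/\ Phi w x y <= q ^ n%:Z * Phi v x y, Beta w x y <= q ^ n%:Z * Beta v x y
    & Beta w x y = q ^ n%:Z * Beta v x y -> Phi w x y = Phi v x y].
Proof. by move=> xy [s [ps <- <-]]; apply: path_Phi_Beta. Qed.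

Lemma Phi_sym v x y : Phi v y x = Phi v x y.
Proof.
by rewrite Phi.unlock phi.unlock wedgeC laurent_absN mulrAC.
Qed.

Lemma Beta_sym v x y : Beta v y x = (Beta v x y)^-1.
Proof. by rewrite Beta.unlock beta.unlock invf_div. Qed.

Definition bmx x y : 'M[F]_2 := \matrix_(i, j) if i == 0 then x 0 j else y 0 j.

Lemma bmxE x y : (forall j, bmx x y 0 j = x 0 j) * (forall j, bmx x y 1 j = y 0 j).
Proof. by split=> j; rewrite mxE. Qed.

Lemma det_bmx x y : \det (bmx x y) = wedge x y.
Proof. by rewrite det2E !bmxE. Qed.

Lemma bmx_unit x y : wedge x y != 0 -> bmx x y \in unitmx.
Proof. by rewrite unitmxE unitfE det_bmx. Qed.

Lemma bmx_mul x y g : bmx x y *m g = bmx (x *m g) (y *m g).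
Proof.
by apply/matrixP => i j; move: i; apply: ord2P; rewrite mulmx2E !bmxE mulmx2E.
Qed.

Lemma bmx_scale c x y : c *: bmx x y = bmx (c *: x) (c *: y).
Proof.
by apply/matrixP => i j; move: i; apply: ord2P; rewrite mxE !bmxE mxE.
Qed.

Lemma bmx_comb x y (d : 'rV[F]_2) : d *m bmx x y = d 0 0 *: x + d 0 1 *: y.
Proof. by apply/rowP => j; rewrite mulmx2E !bmxE !mxE. Qed.

Lemma lnorm_bmx x y c d : wedge x y != 0 ->
  lnorm (bmx x y) (c *: x + d *: y) = Num.max (abs c) (abs d).
Proof.
move=> xy; pose e : 'rV[F]_2 := \row_j if j == 0 then c else d.
have -> : c *: x + d *: y = e *m bmx x y by rewrite bmx_comb !mxE.
by rewrite lnorm.unlock (mulmxK (bmx_unit xy)) /vnorm !mxE.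
Qed.

Lemma lnorm_bmxl x y : wedge x y != 0 -> lnorm (bmx x y) x = 1.
Proof.
move=> xy; have := lnorm_bmx 1 0 xy; rewrite scale1r scale0r addr0 => ->.
by rewrite laurent_abs0 laurent_abs1 (max_idPl _) ?ler01.
Qed.

Lemma lnorm_bmxr x y : wedge x y != 0 -> lnorm (bmx x y) y = 1.
Proof.
move=> xy; have := lnorm_bmx 0 1 xy; rewrite scale1r scale0r add0r => ->.
by rewrite laurent_abs0 laurent_abs1 (max_idPr _) ?ler01.
Qed.

Lemma bmx_adjacent_l x y : wedge x y != 0 ->
  adjacent (vmx (bmx x y)) (vmx (bmx (pi *: x) y)).
Proof.
move=> xy; apply/(adjacentP R).
exists (bmx x y), (bmx (pi *: delta_mx 0 0) (delta_mx 0 1)).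
have p1 : abs pi <= 1 by rewrite laurent_abs_pi invf_le1 ?q_gt0// ltW ?q_gt1.
split.
- exact: bmx_unit.
- apply: ord2P => j; rewrite bmxE !mxE; move: j; apply: ord2P;
  by rewrite ?mulr1 ?mulr0 ?laurent_abs0 ?laurent_abs1.
- by rewrite det_bmx /wedge !mxE /= !mulr1 !mulr0 subr0 laurent_abs_pi.
- by [].
- by rewrite bmx_mul -scalemxAl !bmx_comb !mxE /= !scale0r !scale1r add0r addr0.
Qed.

Lemma swap_lat x y : wedge x y != 0 -> vmx (bmx y x) = vmx (bmx x y).
Proof.
move=> xy; pose M := bmx (delta_mx 0 1) (delta_mx 0 0).
have -> : bmx y x = M *m bmx x y.
  by rewrite bmx_mul !bmx_comb !mxE /= !scale0r !scale1r add0r addr0.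
rewrite /vmx (@lat_eq_mul R) ?bmx_unit//.
  apply: ord2P => j; rewrite bmxE !mxE; move: j; apply: ord2P;
  by rewrite ?laurent_abs0 ?laurent_abs1.
rewrite det_bmx /wedge !mxE /= mulr0 mulr1 sub0r.
by rewrite laurent_absN laurent_abs1.
Qed.

Lemma bmx_adjacent_r x y : wedge x y != 0 ->
  adjacent (vmx (bmx x y)) (vmx (bmx x (pi *: y))).
Proof.
move=> xy; have yx : wedge y x != 0 by rewrite wedgeC oppr_eq0.
have xpy : wedge x (pi *: y) != 0 by rewrite wedgeZr mulf_neq0 ?(laurent_pi_neq0 R).
by rewrite -(swap_lat xy) -(swap_lat xpy); apply: bmx_adjacent_l.
Qed.

Lemma wedge_piX x y n : wedge x y != 0 -> wedge (pi ^ n *: x) y != 0.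
Proof.
by move=> xy; rewrite wedgeZl mulf_neq0// expfz_neq0 ?(laurent_pi_neq0 R).
Qed.

(** Increasing [n] leads towards the end of [y]; for the standard basis these are the vertices
    [v_n]. *)
Definition apt x y n := vmx (bmx (pi ^ n *: x) y).

Lemma pi_exp_neq0 n : pi ^ n != 0.
Proof. by rewrite expfz_neq0 ?(laurent_pi_neq0 R). Qed.

Lemma pi_expD m n : pi ^ (m + n) = pi ^ m * pi ^ n.
Proof. by rewrite expfzDr ?(laurent_pi_neq0 R). Qed.

Lemma apt_adjacent x y n : wedge x y != 0 -> adjacent (apt x y n) (apt x y (n + 1)).
Proof.
move=> xy; rewrite /apt addrC pi_expD expr1z -scalerA.
exact/bmx_adjacent_l/wedge_piX.
Qed.

Lemma apt_sym x y n : wedge x y != 0 -> apt y x n = apt x y (- n).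
Proof.
move=> xy; rewrite /apt -(swap_lat (wedge_piX (- n) xy)).
rewrite -(vmx_scale (bmx (pi ^ n *: y) x) (pi_exp_neq0 (- n))) bmx_scale scalerA.
by rewrite -pi_expD addNr expr0z scale1r.
Qed.

Lemma apt_walk x y m (k : nat) : wedge x y != 0 ->
  walk (apt x y m) (apt x y (m + k%:Z)) k.
Proof.
move=> xy; rewrite -{1}[m]addr0; apply: (walk_seq (f := fun i => apt x y (m + i%:Z))).
by move=> i; rewrite -addn1 PoszD addrA; apply: apt_adjacent.
Qed.

(** Apartment vertices are thus at distance 0, and [Beta] recovers their index. *)
Lemma apt_Phi_Beta x y n : wedge x y != 0 ->
  Phi (apt x y n) x y = 1 /\ Beta (apt x y n) x y = q ^ n.
Proof.
move=> xy; have xyn := wedge_piX n xy; have gu := bmx_unit xyn.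
have hx : lnorm (bmx (pi ^ n *: x) y) x = q ^ n.
  have := lnorm_bmxl xyn; rewrite lnormZ laurent_abs_piX => h.
  by apply: (mulfI (lt0r_neq0 (qz_gt0 R Fq (- n)))); rewrite h -qzD addNr expr0z.
have hy := lnorm_bmxr xyn.
rewrite (Phi_vmx _ _ _ gu) (Beta_vmx _ _ _ gu) phi.unlock beta.unlock hx hy.
split; last by rewrite divr1.
rewrite mulr1 det_bmx wedgeZl laurent_absM laurent_abs_piX mulrAC -qzD addNr expr0z.
by rewrite mul1r divff ?laurent_abs_eq0.
Qed.

End Apartments.

(** * Paths to an apartment, and apartments as geodesic lines *)

Section Geodesics.
Variables (R : realType) (Fq : finFieldType).
Local Notation F := (laurent Fq).
Local Notation pi := (laurent_pi Fq).
Local Notation q := (#|Fq|%:R : R).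
Local Notation abs := (@laurent_abs Fq R).
Local Notation lnorm := (@lnorm R Fq).
Local Notation phi := (@phi R Fq).
Local Notation beta := (@beta R Fq).
Local Notation Phi := (@Phi R Fq).
Local Notation Beta := (@Beta R Fq).
Local Notation integral := (@integral R Fq).
Implicit Types (x y : 'rV[F]_2) (g M : 'M[F]_2) (c : F) (m n : int) (k : nat).
Implicit Types (v w : set (set 'rV[F]_2)) (a b : option F).

Lemma piX_normalize g x : g \in unitmx -> x != 0 ->
  exists i (c : 'rV[F]_2), vnorm R c = 1 /\ pi ^ i *: x = c *m g.
Proof.
move=> gu x0; have [i hi] := lnorm_val R gu x0; exists i, (pi ^ i *: x *m invmx g).
have <- : lnorm g (pi ^ i *: x) = 1.
  by rewrite lnormZ laurent_abs_piX hi -qzD addNr expr0z.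
by rewrite lnorm.unlock (mulmxKV gu).
Qed.

Lemma complete_basis (d : 'rV[F]_2) : vnorm R d = 1 ->
  exists e, vnorm R e = 1 /\ abs (wedge d e) = 1.
Proof.
have h0 : vnorm R (delta_mx 0 0 : 'rV[F]_2) = 1.
  by rewrite /vnorm !mxE /= laurent_abs0 laurent_abs1 (max_idPl _) ?ler01.
have h1 : vnorm R (delta_mx 0 1 : 'rV[F]_2) = 1.
  by rewrite /vnorm !mxE /= laurent_abs0 laurent_abs1 (max_idPr _) ?ler01.
move=> d1; have [j hj] := vnorm_attained R d.
rewrite d1 in hj; move: j hj; apply: ord2P => hj.
  exists (delta_mx 0 1); split=> //.
  by rewrite /wedge !mxE /= mulr1 mulr0 subr0 -hj.
exists (delta_mx 0 0); split=> //.
by rewrite /wedge !mxE /= mulr1 mulr0 sub0r laurent_absN -hj.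
Qed.

Lemma bmx_integral x y : vnorm R x <= 1 -> vnorm R y <= 1 -> integral (bmx x y).
Proof.
move=> /vnorm_le hx /vnorm_le hy.
by apply: ord2P => j; rewrite bmxE.
Qed.

(** Scale the two lines to primitive vectors [X], [Y] of the lattice and complete [X] to a basis
    [X, E]. In [Y = al X + de E], [|de| = q^-k] measures how far the lines agree modulo powers of
    [pi]. So [X, Y] span the lattice of [X, pi^k E], which is reached by scaling [E] in [k]
    steps. *)
Lemma walk_apt g x y : g \in unitmx -> wedge x y != 0 ->
  exists k n, phi g x y = q ^ (- k%:Z) /\ walk (vmx g) (apt x y n) k.
Proof.
move=> gu xy; have [x0 y0] := wedge_neq0 xy.
have [i [c [c1 Xc]]] := piX_normalize gu x0.
have [j [d [d1 Yd]]] := piX_normalize gu y0.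
have [e [e1 ce]] := complete_basis c1.
have ce0 : wedge c e != 0 by rewrite -(laurent_abs_eq0 R) ce oner_eq0.
have cdg : wedge c d * \det g = pi ^ i * (pi ^ j * wedge x y).
  by rewrite -wedgeM -Xc -Yd wedgeZl wedgeZr.
have XY : wedge (c *m g) (d *m g) != 0.
  by rewrite wedgeM cdg !mulf_neq0 ?(pi_exp_neq0 R).
have cd0 : wedge c d != 0.
  by apply: contraNN XY => /eqP cd0; rewrite wedgeM cd0 mul0r.
have phi_cd : phi g x y = abs (wedge c d).
  have hX : lnorm g (pi ^ i *: x) = 1 by rewrite lnorm.unlock Xc (mulmxK gu).
  have hY : lnorm g (pi ^ j *: y) = 1 by rewrite lnorm.unlock Yd (mulmxK gu).
  move: (congr1 abs cdg) hX hY; rewrite !laurent_absM !lnormZ phi.unlock.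
  have := abs_det_gt0 R gu; have := lnorm_gt0 R gu x0; have := lnorm_gt0 R gu y0.
  move: (abs (pi ^ i)) (abs (pi ^ j)) (lnorm g x) (lnorm g y) (abs (\det g)).
  move: (abs (wedge c d)) (abs (wedge x y)).
  move=> W V A B N1 N2 D N20 N10 D0 h hA hB.
  have e0 : N1 != 0 by rewrite gt_eqF.
  have e2 : N2 != 0 by rewrite gt_eqF.
  have e3 : D != 0 by rewrite gt_eqF.
  apply: (mulIf e3); rewrite h.
  transitivity ((A * N1) * (B * N2) * (V / (D * N1 * N2)) * D).
    by rewrite hA hB !mul1r.
  by field; rewrite e0 e2 e3.
(* The coordinates of [d] in the basis [c, e], by Cramer's rule. *)
pose al := wedge d e / wedge c e; pose de := wedge c d / wedge c e.
have d_eq : d = al *: c + de *: e.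
  apply/rowP; apply: ord2P; rewrite !mxE /al /de; move: ce0; rewrite /wedge => ce0;
    by field.
have [n hn] := laurent_abs_val R cd0.
have n0 : n <= 0.
  by rewrite -(qz_le R Fq) -hn expr0z; have := abs_wedge R c d; rewrite c1 d1 mulr1.
pose k := absz n; have nk : n = - k%:Z by rewrite /k; clear -n0; lia.
exists k, (i - j); split; first by rewrite phi_cd hn nk.
have dg_eq : d *m g = al *: (c *m g) + de *: (e *m g).
  by rewrite {1}d_eq mulmxDl -!scalemxAl.
have XE : wedge (c *m g) (e *m g) != 0 by rewrite wedgeM mulf_neq0 ?det_neq0.
have -> : vmx g = vmx (bmx (c *m g) (pi ^ 0%:Z *: (e *m g))).
  rewrite expr0z scale1r -bmx_mul /vmx (lat_eq_mul (R := R) gu)//.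
    by apply: bmx_integral; rewrite ?c1 ?e1.
  by rewrite det_bmx.
move: XE XY Xc Yd dg_eq; move: (c *m g) (d *m g) (e *m g) => X Y E XE XY Xc Yd Y_eq.
(* Scaling by [pi ^ j] turns the basis [pi ^ (i - j) x, y] into [X, Y]; from there to [X, pi ^ k E]
   the transition matrix is triangular and integral, with diagonal [1, t] and [|t| = 1]. *)
have -> : apt x y (i - j) = vmx (bmx X (pi ^ k%:Z *: E)).
  rewrite /apt -(vmx_scale _ (pi_exp_neq0 R Fq j)) bmx_scale scalerA -(pi_expD R).
  rewrite [j + _]addrC subrK Xc Yd /vmx; pose t := de * pi ^ (- k%:Z).
  have t1 : abs t = 1.
    rewrite /t /de !laurent_absM laurent_absV ce invr1 mulr1 laurent_abs_piX.
    by rewrite hn nk -qzD addrN expr0z.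
  pose f := delta_mx 0 0 : 'rV[F]_2; pose h : 'rV[F]_2 := \row_j if j == 0 then al else t.
  have -> : bmx X Y = bmx f h *m bmx X (pi ^ k%:Z *: E).
    rewrite bmx_mul !bmx_comb !mxE /= scale1r scale0r addr0; congr bmx.
    rewrite scalerA /t -mulrA -(pi_expD R) addNr expr0z mulr1.
    exact: Y_eq.
  rewrite (lat_eq_mul (R := R))//.
  - by rewrite bmx_unit// wedgeZr mulf_neq0 ?(pi_exp_neq0 R).
  - apply: bmx_integral; apply/vnorm_le; apply: ord2P; rewrite !mxE /=.
    + by rewrite laurent_abs1.
    + by rewrite laurent_abs0.
    + rewrite /al laurent_absM laurent_absV ce invr1 mulr1.
      by have := abs_wedge R d e; rewrite d1 e1 mulr1.
    + by rewrite t1.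
  - by rewrite det_bmx /wedge !mxE /= mul1r mul0r subr0.
apply: (walk_seq (f := fun k : nat => vmx (bmx X (pi ^ k%:Z *: E)))) => m.
rewrite intS (pi_expD R) expr1z -scalerA.
by apply: (bmx_adjacent_r R); rewrite wedgeZr mulf_neq0 ?(pi_exp_neq0 R).
Qed.

Lemma vertex_act_vmx g h : vertex_act g (vmx h) = vmx (h *m invmx g).
Proof.
rewrite /vertex_act; apply/seteqP; split=> L.
  case=> K /vmxP[c c0 ->] <-; apply/vmxP; exists c => //.
  rewrite scalemxAl; apply/seteqP; split=> x.
    by case=> _ [d hd <-] <-; exists d => //; rewrite mulmxA.
  by case=> d hd <-; exists (d *m (c *: h)); [exists d | rewrite mulmxA].
case/vmxP=> c c0 ->; exists (lat (c *: h)); first by apply/vmxP; exists c.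
rewrite scalemxAl; apply/seteqP; split=> x.
  by case=> _ [d hd <-] <-; exists d => //; rewrite mulmxA.
by case=> d hd <-; exists (d *m (c *: h)); [exists d | rewrite mulmxA].
Qed.

Lemma std_vertexE n : @std_vertex Fq n = apt (delta_mx 0 0) (delta_mx 0 1) n.
Proof.
rewrite /std_vertex /apt /vmx; congr homothety_class; apply/seteqP; split=> x.
  case=> c [d [hc hd ->]]; exists (\row_j if j == 0 then c else d).
    by apply: ord2P; rewrite mxE.
  by rewrite bmx_comb !mxE /= scalerA mulrC.
case=> d hd <-; exists (d 0 0), (d 0 1); split; [exact: hd|exact: hd|].
by rewrite bmx_comb scalerA mulrC.
Qed.

(* A row vector vanishing at [a]; on these [g] acts by [x |-> x *m g^-1]. *)
Definition ptv a : 'rV[F]_2 :=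
  if a is Some t then \row_j (if j == 0 then 1 else - t) else delta_mx 0 1.

Lemma ptv_wedge a b : a <> b -> wedge (ptv a) (ptv b) != 0.
Proof.
case: a b => [t|] [u|] ab; rewrite /wedge !mxE /= ?mul0r ?mul1r ?mulr0 ?mulr1.
- by rewrite opprK addrC subr_eq0; apply/eqP => tu; apply: ab; rewrite tu.
- by rewrite subr0 oner_eq0.
- by rewrite sub0r oppr_eq0 oner_eq0.
- by case: ab.
Qed.

Lemma ptv_inj c a b : ptv a = c *: ptv b -> a = b.
Proof.
move=> h; apply: contrapT => /ptv_wedge/eqP; apply.
by rewrite h wedgeZl /wedge [X in X - _]mulrC subrr mulr0.
Qed.

Lemma ptv_mobius g a : g \in unitmx ->
  exists2 c, c != 0 & ptv (mobius g a) *m g = c *: ptv a.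
Proof.
move=> /det_neq0; rewrite det2E => D0; pose D := g 0 0 * g 1 1 - g 0 1 * g 1 0.
case: a => [t|] /=.
  case: eqP => [e|/eqP e].
    (* [mobius g] sends [t] to infinity: the second row of [g] is a multiple of [(1, - t)], nonzero
       since [g] is invertible. *)
    exists (g 1 0).
      apply: contraNN D0 => /eqP g10; move: e; rewrite g10 mul0r add0r => ->.
      by rewrite !mulr0 subrr.
    apply/rowP; apply: ord2P; rewrite mulmx2E !mxE /= mul0r add0r mul1r ?mulr1//.
    by apply/eqP; rewrite mulrN -addr_eq0 addrC e.
  exists (D / (g 1 0 * t + g 1 1)); first by rewrite mulf_neq0 ?invr_eq0.
  by apply/rowP; apply: ord2P; rewrite mulmx2E !mxE /= /D; field.
case: eqP => [e|/eqP e].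
  exists (g 1 1); first by apply: contraNN D0 => /eqP ->; rewrite e !mulr0 subrr.
  by apply/rowP; apply: ord2P; rewrite mulmx2E !mxE /= mul0r add0r mul1r ?mulr1 ?mulr0 ?e.
exists (- D / g 1 0); first by rewrite mulf_neq0 ?invr_eq0 ?oppr_eq0.
by apply/rowP; apply: ord2P; rewrite mulmx2E !mxE /= /D; field.
Qed.

Lemma ptv_mobius_inv g a : g \in unitmx ->
  exists2 c, c != 0 & ptv (mobius (invmx g) a) = c *: (ptv a *m g).
Proof.
move=> gu; have giu : invmx g \in unitmx by rewrite unitmx_inv.
have [c c0 h] := ptv_mobius a giu; exists c => //.
by rewrite scalemxAl -h mulmxKV.
Qed.

Lemma vertex_act_apt g x y n :
  vertex_act g (apt x y n) = apt (x *m invmx g) (y *m invmx g) n.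
Proof. by rewrite /apt vertex_act_vmx bmx_mul scalemxAl. Qed.

Lemma apt_represents a b : a <> b -> represents (fun k => apt (ptv a) (ptv b) k%:Z) b.
Proof.
move=> ab; have w := ptv_wedge ab; split; first split.
- move=> m n /(congr1 (fun v => Beta v (ptv a) (ptv b))).
  by rewrite (apt_Phi_Beta R m%:Z w).2 (apt_Phi_Beta R n%:Z w).2 => /qz_inj[].
- by move=> n; rewrite -addn1 PoszD; apply: (apt_adjacent R).
(* The action multiplies by the inverse, so this matrix takes the standard basis to [ptv a, ptv b],
   and infinity to [b]. *)
have u := bmx_unit w; exists (invmx (bmx (ptv a) (ptv b))); split.
- by rewrite unitmx_inv.
- have [c c0 h] := ptv_mobius_inv None u.
  by apply: (ptv_inj (c := c)); rewrite h /= bmx_comb !mxE /= scale0r add0r scale1r.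
exists 0%N, 0%N => k; rewrite !add0n std_vertexE vertex_act_apt invmxK !bmx_comb.
by rewrite !mxE /= !scale0r !scale1r addr0 add0r.
Qed.

(** There is no shortcut: [Beta] equals [q^n] at index [n] and changes by at most a factor [q] per
    edge. Applying this to both orders of [x, y] covers both signs of [m - n]. *)
Lemma apt_tree_dist x y m n : wedge x y != 0 ->
  tree_dist R (apt x y m) (apt x y n) = (`|m - n|%:~R)%:E.
Proof.
move=> xy; have -> : `|m - n|%:~R = (absz (m - n)%R)%:R :> R by rewrite -abszE -pmulrn.
apply/eqP; rewrite eq_le; apply/andP; split.
  apply: tree_dist_le; have [mn|/ltW nm] := leP m n.
    have e : n = m + (absz (m - n)%R)%:Z by clear -mn; lia.
    by rewrite [X in walk _ (apt x y X) _]e; apply: (apt_walk R).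
  apply: (walk_sym R); have e : m = n + (absz (m - n)%R)%:Z by clear -nm; lia.
  by rewrite [X in walk _ (apt x y X) _]e; apply: (apt_walk R).
rewrite leNgt; apply/negP; case E : (absz (m - n)%R) => [|d].
  move=> /ereal_inf_lt[_ [s _ <-]]; rewrite lte_fin ltr_nat; lia.
move=> /tree_dist_leP[k kd hw]; have yx : wedge y x != 0 by rewrite wedgeC oppr_eq0.
have [_ + _] := walk_Phi_Beta R xy hw; have [_ + _] := walk_Phi_Beta R yx hw.
rewrite ![Beta _ y x]Beta_sym !(apt_Phi_Beta R _ xy).2 !invr_expz -!qzD !qz_le.
by move: E kd; clear; lia.
Qed.

Lemma apt_geodesic a b : a <> b -> geodesic_line R (apt (ptv a) (ptv b)) a b.
Proof.
move=> ab; have w := ptv_wedge ab; split.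
- by move=> m n; apply: apt_tree_dist.
- have ba : b <> a by move=> /esym.
  have -> : (fun n : nat => apt (ptv a) (ptv b) (- n%:Z)) =
            (fun n : nat => apt (ptv b) (ptv a) n%:Z).
    by apply/funext => n; exact/esym/(apt_sym R).
  exact (apt_represents ba).
- exact (apt_represents ab).
Qed.

End Geodesics.

(** * The distance from a vertex to a geodesic *)

Section TreeDistance.
Variables (R : realType) (Fq : finFieldType).
Local Notation F := (laurent Fq).
Local Notation pi := (laurent_pi Fq).
Local Notation q := (#|Fq|%:R : R).
Local Notation abs := (@laurent_abs Fq R).
Local Notation lnorm := (@lnorm R Fq).
Local Notation phi := (@phi R Fq).
Local Notation Phi := (@Phi R Fq).
Local Notation Beta := (@Beta R Fq).
Implicit Types (x y : 'rV[F]_2) (g M : 'M[F]_2) (c : F) (m n : int) (k : nat).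
Implicit Types (v w : set (set 'rV[F]_2)) (a b : option F).

(** Apartments with a common end merge: once [|e| <= |c| q^n], the vector [pi ^ n z / c] can replace
    [pi ^ n p] in the lattice basis, so the vertex also lies in the apartment of [z] and [y]. *)
Lemma apt_Phi_Beta_comb p x y c d e n : wedge p y != 0 -> c != 0 -> d != 0 ->
  abs e <= abs c * q ^ n ->
  let z := c *: p + e *: y in
  Phi (apt p y n) z (d *: y) = 1 /\
  Beta (apt p y n) z (d *: y) = abs c / abs d * q ^ n.
Proof.
move=> py c0 d0 hn z; have pyn := wedge_piX R n py; have gu := bmx_unit pyn.
have hz : lnorm (bmx (pi ^ n *: p) y) z = abs c * q ^ n.
  have -> : z = (c * pi ^ (- n)) *: (pi ^ n *: p) + e *: y.
    by rewrite scalerA -mulrA -(pi_expD R) addNr expr0z mulr1.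
  by rewrite lnorm_bmx// laurent_absM laurent_abs_piX opprK (max_idPl hn).
have hy : lnorm (bmx (pi ^ n *: p) y) (d *: y) = abs d.
  by rewrite lnormZ lnorm_bmxr// mulr1.
rewrite /apt (Phi_vmx _ _ _ gu) (Beta_vmx _ _ _ gu) phi.unlock beta.unlock hz hy.
split; last by rewrite mulrAC.
have -> : wedge z (d *: y) = c * (d * wedge p y).
  by rewrite /z /wedge !mxE; ring.
rewrite det_bmx wedgeZl !laurent_absM laurent_abs_piX.
have q0 := qz_gt0 R Fq n; rewrite -invr_expz.
move: py c0 d0; rewrite -!(laurent_abs_eq0 R).
move: (abs (wedge p y)) (abs c) (abs d) (q ^ n) q0 => W C D Q Q0 W0 C0 D0.
by field; rewrite W0 C0 D0 gt_eqF.
Qed.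

Lemma represents_asymp s b x : represents s b -> wedge x (ptv b) != 0 ->
  exists K, forall k, (K <= k)%N -> Phi (s k) x (ptv b) = 1 /\
    Beta (s k.+1) x (ptv b) = q * Beta (s k) x (ptv b).
Proof.
case=> _ [g [gu gb [m [n hs]]]] xb.
have [c c0 hc] := ptv_mobius None gu; rewrite gb /= in hc.
pose p : 'rV[F]_2 := delta_mx 0 0 *m invmx g.
pose p' : 'rV[F]_2 := delta_mx 0 1 *m invmx g.
have bp : ptv b = c *: p' by rewrite /p' scalemxAl -hc (mulmxK gu).
have pp : wedge p p' != 0.
  rewrite wedgeM mulf_neq0 ?det_neq0 ?unitmx_inv// /wedge !mxE /=.
  by rewrite mulr1 mulr0 subr0 oner_eq0.
have sE k : s (m + k)%N = apt p p' (n + k)%N%:Z.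
  by rewrite hs std_vertexE vertex_act_apt.
have xE : exists al be, x = al *: p + be *: p'.
  exists ((x *m invmx (bmx p p')) 0 0), ((x *m invmx (bmx p p')) 0 1).
  by rewrite -bmx_comb (mulmxKV (bmx_unit pp)).
move: xE => [al [be xE]]; have al0 : al != 0.
  by apply: contraNN xb => /eqP al0; rewrite xE bp al0 scale0r add0r /wedge !mxE;
    apply/eqP; ring.
(* From index [K] on, the translated standard half-line lies in the apartment of [x] and [ptv b]. *)
have [K hK] := expq_unbounded Fq (abs be / abs al).
have hKk k : (K <= k)%N -> abs be <= abs al * q ^ k%:Z.
  move=> Kk; rewrite mulrC -ler_pdivrMr ?laurent_abs_gt0//; apply: le_trans (ltW hK) _.
  by rewrite exprnP qz_le; lia.
exists (m + K)%N => k mk; have -> : k = (m + (k - m))%N by rewrite subnKC//; lia.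
have h1 : (K <= n + (k - m))%N by move: mk; clear; lia.
have h2 : (K <= n + (k - m).+1)%N by move: mk; clear; lia.
rewrite -addnS !sE bp xE.
have [-> ->] := apt_Phi_Beta_comb x pp al0 c0 (hKk _ h1).
have [_ ->] := apt_Phi_Beta_comb x pp al0 c0 (hKk _ h2).
by split=> //; rewrite addnS intS qzD expr1z; ring.
Qed.

(** The threshold [1] will tell the two ends of a line apart: [Beta] exceeds it near one end and
    lies below it near the other. *)
Lemma Beta_asymp s b x : represents s b -> wedge x (ptv b) != 0 ->
  exists K, forall k, (K <= k)%N -> Phi (s k) x (ptv b) = 1 /\
    1 < Beta (s k) x (ptv b).
Proof.
move=> hs xb; have [K hK] := represents_asymp hs xb.
have q0 := q_gt0 R Fq; have q1 := q_gt1 R Fq.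
have BK : 0 < Beta (s K) x (ptv b) by apply: Beta_gt0.
have hB j : Beta (s (K + j)%N) x (ptv b) = q ^+ j * Beta (s K) x (ptv b).
  elim: j => [|j IH]; first by rewrite addn0 mul1r.
  by rewrite addnS (hK (K + j)%N (leq_addr _ _)).2 IH exprS mulrA.
have [J hJ] := expq_unbounded Fq (Beta (s K) x (ptv b))^-1.
exists (K + J)%N => k hk; split.
  by apply: (hK _ _).1; apply: leq_trans hk; apply: leq_addr.
have -> : k = (K + (k - K))%N by rewrite subnKC//; apply: leq_trans hk; apply: leq_addr.
rewrite hB -ltr_pdivrMr// div1r; apply: lt_le_trans hJ _.
by rewrite ler_weXn2l ?ltW// leq_subRL//; apply: leq_trans hk; apply: leq_addr.
Qed.

(* Far out, the line has reached the apartment at both ends; as its points are at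
   the same distance as in the apartment, Beta grows at each step between them,
   which forces Phi to remain constant. *)
Lemma geodesic_Phi s a b m : a <> b -> geodesic_line R s a b ->
  Phi (s m) (ptv a) (ptv b) = 1.
Proof.
move=> ab [hd ha hb]; have ba : b <> a by move=> /esym.
have wab := ptv_wedge ab; have wba := ptv_wedge ba.
have [K hK] := Beta_asymp hb wab; have [K' hK'] := Beta_asymp ha wba.
(* Beyond both thresholds, and large enough for [s m] to lie between [s (- k)] and [s k]. *)
pose k := maxn (maxn K K') (absz m).
have [Pw Bw] : Phi (s k%:Z) (ptv a) (ptv b) = 1 /\ 1 < Beta (s k%:Z) (ptv a) (ptv b).
  by apply: hK; rewrite /k -maxnA leq_maxl.
have [Pv Bv] : Phi (s (- k%:Z)) (ptv b) (ptv a) = 1 /\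
    1 < Beta (s (- k%:Z)) (ptv b) (ptv a).
  by apply: hK'; rewrite /k [maxn K K']maxnC -maxnA leq_maxl.
have km : (absz m <= k)%N by rewrite /k leq_maxr.
move: k Pw Bw Pv Bv km => k Pw Bw; rewrite Phi_sym Beta_sym => Pv Bv km.
(* [Phi = 1] makes the path of [walk_apt] empty. *)
have in_apt v : vertex v -> Phi v (ptv a) (ptv b) = 1 ->
    exists i, v = apt (ptv a) (ptv b) i.
  move=> /vertexP[g gu ->]; rewrite (Phi_vmx _ _ _ gu).
  have [j [i [-> [[|x t] [ps ls <-]]]]] := walk_apt R gu wab; first by exists i.
  by rewrite -(expr0z q) => /qz_inj.
have vert n : vertex (s n).
  have := ha.1.2; have := hb.1.2; case: n => n h1 h2; first by have [] := h1 n.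
  by have [] := h2 n.+1; rewrite NegzE.
have [i hi] := in_apt _ (vert _) Pv; have [j hj] := in_apt _ (vert _) Pw.
have Bi := (apt_Phi_Beta R i wab).2; have Bj := (apt_Phi_Beta R j wab).2.
rewrite -hi in Bi; rewrite -hj in Bj.
have ij : i < j.
  rewrite -(qz_lt R Fq) -Bi -Bj; apply: lt_trans Bw.
  by move: Bv; rewrite invf_gt1//; apply: Beta_gt0.
have dij : (k + k <= absz (j - i))%N.
  have := hd (- k%:Z) k%:Z; rewrite hi hj (apt_tree_dist R i j wab) => -[].
  move=> /eqP; rewrite eqr_int => /eqP; clear -ij; lia.
have walk_s m1 m2 : exists2 l : nat, (l <= absz (m1 - m2))%N & walk (s m1) (s m2) l.
  by apply: (tree_dist_leP (R := R)); rewrite hd lte_fin -natr_absz// ltr_nat; lia.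
have [l1 hl1 w1] := walk_s (- k%:Z) m; have [l2 hl2 w2] := walk_s m k%:Z.
have [_ h1 e1] := walk_Phi_Beta R wab w1; have [_ h2 _] := walk_Phi_Beta R wab w2.
rewrite e1 ?Pv//; apply/eqP; rewrite eq_le h1 /=.
rewrite -(ler_pM2l (qz_gt0 R Fq l2)); apply: le_trans h2.
rewrite mulrA -qzD Bi Bj -qzD qz_le.
by clear -hl1 hl2 dij ij km; lia.
Qed.

(** [Phi] is 1 on every geodesic and changes by at most a factor [q] per edge; conversely [walk_apt]
    ends on the apartment, which is a geodesic. *)
Lemma tree_dist_set_geodesic g a b k : g \in unitmx -> a <> b ->
  (tree_dist_set R (vmx g) (geodesic R a b) <= k%:R%:E)%E <->
  q ^- k <= phi g (ptv a) (ptv b).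
Proof.
move=> gu ab; have w := ptv_wedge ab; split=> [h|h].
  (* The strict bound [k + 1] extracts a witness from the infimum; lengths being integers, nothing
     is lost. *)
  have /ereal_inf_lt[_ [v [s hs [n _ <-]] <-]] :
      (tree_dist_set R (vmx g) (geodesic R a b) < k.+1%:R%:E)%E.
    by apply: le_lt_trans h _; rewrite lte_fin ltr_nat.
  move=> /tree_dist_leP[m mk /(walk_Phi_Beta R w)[+ _ _]].
  rewrite (geodesic_Phi _ ab hs) (Phi_vmx _ _ _ gu) => h1.
  have q0 := exprn_gt0 k (q_gt0 R Fq).
  rewrite -[_ ^- _]mul1r ler_pdivrMr// mulrC; apply: le_trans h1 _.
  rewrite ler_pM2r ?exprnP ?qz_le ?lez_nat//.
  by rewrite -(Phi_vmx _ _ _ gu) Phi_gt0.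
have [m [n [hm wm]]] := walk_apt R gu w.
apply: ge_ereal_inf; exists (tree_dist R (vmx g) (apt (ptv a) (ptv b) n)).
  exists (apt (ptv a) (ptv b) n) => //.
  by exists (apt (ptv a) (ptv b)); [exact: apt_geodesic | exists n].
apply: le_trans (tree_dist_le R wm) _; rewrite lee_fin ler_nat.
by move: h; rewrite hm exprnN qz_le; lia.
Qed.

End TreeDistance.

(** * Norms on the Drinfeld half-plane *)

Section HalfPlaneBounds.
Variables (R : realType) (Fq : finFieldType) (CC : Cinfty R Fq).
Local Notation F := (laurent Fq).
Local Notation C := (Cinf CC).
Local Notation q := (#|Fq|%:R : R).
Local Notation abs := (@laurent_abs Fq R).
Local Notation FC := (F_to_C CC).
Implicit Types (z w : C) (x y : 'rV[F]_2) (a b : option F).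

Lemma Cabs0 : Cabs (0 : C) = 0.
Proof. exact/Cabs_eq0. Qed.

Lemma Cabs_neq0 z : z != 0 -> Cabs z != 0.
Proof. by apply: contraNN => /eqP/Cabs_eq0/eqP. Qed.

Lemma Cabs_gt0 z : z != 0 -> 0 < Cabs z.
Proof. by move=> z0; rewrite lt_def Cabs_neq0 ?Cabs_ge0. Qed.

Lemma Cabs1 : Cabs (1 : C) = 1.
Proof.
have h := Cabs_neq0 (oner_neq0 C); apply: (mulfI h).
by rewrite -CabsM !mulr1.
Qed.

Lemma CabsX z n : Cabs (z ^+ n) = Cabs z ^+ n.
Proof. by elim: n => [|n IH]; rewrite ?expr0 ?Cabs1// !exprS CabsM IH. Qed.

Lemma CabsN z : Cabs (- z) = Cabs z.
Proof.
rewrite -mulN1r CabsM; suff -> : Cabs (-1 : C) = 1 by rewrite mul1r.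
by apply/eqP; rewrite -(@pexpr_eq1 _ _ 2)// ?Cabs_ge0// -CabsX sqrrN expr1n Cabs1.
Qed.

Lemma CabsV z : Cabs z^-1 = (Cabs z)^-1.
Proof.
have [->|z0] := eqVneq z 0; first by rewrite invr0 Cabs0 invr0.
by apply: (mulfI (Cabs_neq0 z0)); rewrite -CabsM !mulfV ?Cabs1 ?Cabs_neq0.
Qed.

Lemma Cabs_prod (I : Type) (r : seq I) (P : pred I) (f : I -> C) :
  Cabs (\prod_(i <- r | P i) f i) = \prod_(i <- r | P i) Cabs (f i).
Proof. by apply: (big_morph _ (@CabsM _ _ CC) Cabs1). Qed.

Lemma CabsD_le z w (e : R) : Cabs z <= e -> Cabs w <= e -> Cabs (z + w) <= e.
Proof. by move=> hz hw; apply: le_trans (Cabs_ultra _ _) _; rewrite ge_max hz. Qed.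

Lemma CabsD_lt z w (e : R) : Cabs z < e -> Cabs w < e -> Cabs (z + w) < e.
Proof. by move=> hz hw; apply: le_lt_trans (Cabs_ultra _ _) _; rewrite gt_max hz. Qed.

Lemma CabsB_lt z w (e : R) : Cabs z < e -> Cabs w < e -> Cabs (z - w) < e.
Proof. by move=> hz hw; apply: CabsD_lt; rewrite ?CabsN. Qed.

Lemma Cabs_subC z w : Cabs (z - w) = Cabs (w - z).
Proof. by rewrite -CabsN opprB. Qed.

Lemma Cabs_FC (t : F) : Cabs (FC t) = abs t.
Proof. exact: Cabs_extends. Qed.

Lemma FC_rmorph : (forall s t, FC (s + t) = FC s + FC t) *
  (forall s t, FC (s - t) = FC s - FC t) * (forall s t, FC (s * t) = FC s * FC t) *
  (forall t, FC (- t) = - FC t) * (FC 0 = 0) * (FC 1 = 1).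
Proof.
rewrite /F_to_C !(rmorph0, rmorph1).
by do !split=> *; rewrite ?rmorphB ?rmorphD ?rmorphM ?rmorphN.
Qed.

Lemma F_to_CM (s t : F) : FC (s * t) = FC s * FC t.
Proof. by rewrite FC_rmorph. Qed.

Lemma Omega_sub z (t : F) : Omega z -> z - FC t != 0.
Proof.
by move=> hz; apply/eqP => /eqP; rewrite subr_eq0 => /eqP e; apply: hz; exists t.
Qed.

Lemma imabs_le z (t : F) : imabs z <= Cabs (z - FC t).
Proof.
apply: ge_inf; last by exists t.
by exists 0 => _ [s _ <-]; apply: Cabs_ge0.
Qed.

Lemma imabs_ge0 z : 0 <= imabs z.
Proof.
apply: lb_le_inf; first by exists (Cabs (z - FC 0)), 0.
by move=> _ [t _ <-]; apply: Cabs_ge0.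
Qed.

(* The limit of a Cauchy sequence [x_n] has the diagonal coefficients [x_n n]. *)
Lemma F_closed z : (forall n : nat, exists t : F, Cabs (z - FC t) < q ^- n) ->
  range FC z.
Proof.
move=> /choice[x hx].
have xx (i : int) m n : i <= m%:Z -> i <= n%:Z -> x m i = x n i.
  wlog mn : m n / (m <= n)%N => [h im jn|im _].
    by have /orP[/h|/h/(_ jn im)->] := leq_total m n; first exact.
  have h : abs (x m - x n) < q ^ (- m%:Z).
    have -> : abs (x m - x n) = Cabs ((z - FC (x n)) - (z - FC (x m))).
      by rewrite -Cabs_FC FC_rmorph; congr Cabs; ring.
    rewrite -exprnN; apply: CabsB_lt => //; apply: lt_le_trans (hx n) _.
    by rewrite !exprnN qz_le lerN2.
  by apply/eqP; rewrite -subr_eq0; apply/eqP; move/laurent_abs_lt: h; apply.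
have bnd : exists N : int, forall n, n < N -> x (absz n) n = 0.
  (* For negative [n] the diagonal coefficient comes from [x (absz n)], which agrees there with
     [x 0]. *)
  have [N hN] := lcoef_bounded (x 0%N); exists (Num.min N 0) => n hn.
  by rewrite (xx n (absz n) 0%N) ?hN//; lia.
exists (Laurent bnd) => //; apply/eqP; rewrite eq_sym -subr_eq0.
apply: contrapT => /negP/Cabs_gt0 h0.
have [n hn] := expq_unbounded Fq (Cabs (z - FC (Laurent bnd)))^-1.
have : Cabs (z - FC (Laurent bnd)) < q ^- n.
  have -> : z - FC (Laurent bnd) = (z - FC (x n)) - FC (Laurent bnd - x n).
    by rewrite FC_rmorph; ring.
  apply: CabsB_lt => //; rewrite Cabs_FC exprnN; apply/laurent_abs_lt => m mn /=.
  by rewrite (xx m (absz m) n) ?subrr//; lia.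
rewrite -[X in X < _]invrK ltf_pV2 ?posrE ?invr_gt0 ?exprn_gt0 ?q_gt0//.
by rewrite ltNge ltW.
Qed.

Lemma imabs_gt0 z : Omega z -> 0 < imabs z.
Proof.
move=> hz; rewrite lt_def imabs_ge0 andbT; apply/eqP => h0; apply: hz.
apply: F_closed => n.
have /inf_lt[] : imabs z < q ^- n by rewrite h0 invr_gt0 exprn_gt0 ?q_gt0.
  by exists (Cabs (z - FC 0)), 0.
by move=> _ [t _ <-] ht; exists t.
Qed.

(** A square root of [pi] has order [1/2], which no element of [F] has. Without a point of Omega,
    convergence would say nothing about the terms. *)
Lemma Omega_nonempty : exists z : C, Omega z.
Proof.
pose p := Fbar_of CC (laurent_pi Fq).
have [s] := @solve_monicpoly (Fbar CC) 2 (fun i => if i == 0%N then p else 0) isT.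
rewrite 2!big_ord_recl big_ord0 /= addr0 expr0 mulr1 mul0r addr0 => hs.
exists (Cinf_of CC s) => -[t _ ht].
have : Cabs (FC t ^+ 2) = q^-1.
  by rewrite ht -rmorphXn hs /p -/(FC _) Cabs_FC laurent_abs_pi.
rewrite CabsX Cabs_FC; have [->|/(laurent_abs_val R)[n ->]] := eqVneq t 0.
  by rewrite laurent_abs0 expr0n => /eqP; rewrite eq_sym invr_eq0 gt_eqF ?q_gt0.
rewrite expr2 -qzD -exprN1 => /qz_inj; lia.
Qed.

Lemma U_imabs m z (t : F) : U_ m z -> q ^- m <= Cabs (z - FC t).
Proof. by case=> _ _ h; apply: le_trans h (imabs_le _ _). Qed.

Lemma Omega_U z : Omega z -> exists m, U_ m z.
Proof.
move=> hz; have i0 := imabs_gt0 hz.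
have [m1 h1] := expq_unbounded Fq (Cabs z); have [m2 h2] := expq_unbounded Fq (imabs z)^-1.
have q0 := q_gt0 R Fq; have q1 := q_gt1 R Fq.
have qm (i j : nat) : (i <= j)%N -> q ^+ i <= q ^+ j by rewrite ler_eXn2l.
exists (maxn m1 m2); split=> //.
  by apply: le_trans (ltW h1) (qm _ _ (leq_maxl _ _)).
rewrite -[imabs z]invrK lef_pV2 ?posrE ?invr_gt0 ?exprn_gt0//.
by apply: le_trans (ltW h2) (qm _ _ (leq_maxr _ _)).
Qed.

Lemma U_mono m n : (m <= n)%N -> U_ m `<=` (U_ n : set C).
Proof.
have q0 := q_gt0 R Fq; have q1 := q_gt1 R Fq.
move=> mn z [hz h1 h2]; split=> //; first by apply: le_trans h1 _; rewrite ler_eXn2l.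
by apply: le_trans h2; rewrite lef_pV2 ?posrE ?exprn_gt0// ler_eXn2l.
Qed.

(* Plays the role of the gauge of a lattice for a point of Omega. *)
Definition zn z x : R := Cabs (FC (x 0 0) * z + FC (x 0 1)).

Lemma znZ z (c : F) x : zn z (c *: x) = abs c * zn z x.
Proof. by rewrite /zn !mxE -Cabs_FC -CabsM !FC_rmorph; congr Cabs; ring. Qed.

Lemma zn_le m z x : U_ m z -> zn z x <= q ^+ m * vnorm R x.
Proof.
case=> _ hz _; have qm : 1 <= q ^+ m by rewrite exprn_ege1 ?ltW ?q_gt1.
apply: CabsD_le; rewrite ?CabsM Cabs_FC.
  by rewrite mulrC ler_pM ?Cabs_ge0 ?laurent_abs_ge0 ?vnorm_ge.
by apply: le_trans (vnorm_ge _ _ _) _; rewrite ler_peMl ?vnorm_ge0.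
Qed.

(** Factoring out [x_0] bounds it with a loss of [q^m], by the distance from [z] to [F]. Then
    [x_1 = (x_0 z + x_1) - x_0 z] costs another [q^m], from [|z|]. *)
Lemma vnorm_zn m z x : U_ m z -> vnorm R x <= q ^+ (m + m) * zn z x.
Proof.
move=> hU; have qm : 1 <= q ^+ m by rewrite exprn_ege1 ?ltW ?q_gt1.
have q0 := exprn_gt0 m (q_gt0 R Fq).
have z0 : 0 <= zn z x by apply: Cabs_ge0.
have h0 : abs (x 0 0) <= q ^+ m * zn z x.
  have [->|x0] := eqVneq (x 0 0) 0; first by rewrite laurent_abs0 mulr_ge0 ?(ltW q0).
  have -> : zn z x = abs (x 0 0) * Cabs (z - FC (- (x 0 1 / x 0 0))).
    rewrite -Cabs_FC -CabsM /zn; congr Cabs; rewrite FC_rmorph opprK mulrDr.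
    by rewrite -F_to_CM mulrCA divff// mulr1.
  rewrite mulrCA ler_peMr ?laurent_abs_ge0// -ler_pdivrMl// mulr1.
  exact: U_imabs.
have h1 : abs (x 0 0) * q ^+ m <= q ^+ (m + m) * zn z x.
  by rewrite exprD -mulrA [X in X <= _]mulrC ler_pM2l.
rewrite /vnorm ge_max; apply/andP; split.
  by apply: le_trans h1; rewrite ler_peMr ?laurent_abs_ge0.
have -> : abs (x 0 1) = Cabs ((FC (x 0 0) * z + FC (x 0 1)) - FC (x 0 0) * z).
  by rewrite addrAC subrr add0r Cabs_FC.
apply: CabsD_le.
  by rewrite ler_peMl// exprD mulr_ege1.
rewrite CabsN CabsM Cabs_FC; apply: le_trans h1.
by case: hU => _ hz _; rewrite ler_wpM2l ?laurent_abs_ge0.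
Qed.

Lemma zn_gt0 z x : Omega z -> x != 0 -> 0 < zn z x.
Proof.
move=> /Omega_U[m hU] /(vnorm_gt0 R) h.
have := lt_le_trans h (vnorm_zn x hU).
by rewrite pmulr_rgt0 ?exprn_gt0 ?q_gt0.
Qed.

Lemma Cabs_u z a b : Omega z ->
  Cabs (u_ z a b) = abs (wedge (ptv a) (ptv b)) / (zn z (ptv a) * zn z (ptv b)).
Proof.
move=> hz; rewrite /u_ /zn -!Cabs_FC -!CabsM -CabsV -CabsM.
have s (t : F) : FC 1 * z + FC (- t) = z - FC t by rewrite !FC_rmorph mul1r.
have s0 : FC 0 * z + FC 1 = 1 by rewrite !FC_rmorph mul0r add0r.
case: a b => [t|] [w|]; rewrite /inv_sub /wedge !mxE /= ?s ?s0 ?sub0r ?subr0.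
- have h1 := Omega_sub t hz; have h2 := Omega_sub w hz.
  rewrite -CabsN !FC_rmorph; congr Cabs; move: h1 h2.
  by move: (FC t) (FC w) => T W h1 h2; field; rewrite h1 h2.
- rewrite ?mulr1 ?mulr0 ?subr0 !FC_rmorph CabsN mul1r.
  by congr Cabs.
- have h2 := Omega_sub w hz; rewrite -CabsN !FC_rmorph; congr Cabs; move: h2.
  by move: (FC w) => W h2; field.
- rewrite !FC_rmorph; by congr Cabs; rewrite oppr0 mulr0 mul0r subrr mul0r.
Qed.

Lemma Cabs_inv_sub z a : Omega z -> Cabs (inv_sub z a) <= (imabs z)^-1.
Proof.
move=> hz; have i0 := imabs_gt0 hz; case: a => [t|] /=; last first.
  by rewrite Cabs0 invr_ge0 ltW.
rewrite CabsV lef_pV2 ?posrE ?imabs_le//.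
exact/Cabs_gt0/Omega_sub.
Qed.

(** Uniform in [a] and [b]; this is the source of the final bound on [f]. *)
Lemma Cabs_u_le z a b : Omega z -> Cabs (u_ z a b) <= (imabs z)^-1.
Proof.
by move=> hz; apply: CabsD_le; rewrite ?CabsN; apply: Cabs_inv_sub.
Qed.

Lemma ratio_le (W X Y V1 V2 P : R) : 0 <= W -> 0 < X -> 0 < Y -> 0 < V1 -> 0 < V2 ->
  V1 <= P * X -> V2 <= P * Y -> W / (X * Y) <= P ^+ 2 * (W / (V1 * V2)).
Proof.
move=> W0 X0 Y0 V10 V20 h1 h2; rewrite ler_pdivrMr ?mulr_gt0//.
have -> : P ^+ 2 * (W / (V1 * V2)) * (X * Y) = W / (V1 * V2) * (P * X * (P * Y)) by ring.
have {1}-> : W = W / (V1 * V2) * (V1 * V2) by rewrite divfK// mulf_neq0// gt_eqF.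
by rewrite ler_wpM2l ?divr_ge0 ?mulr_ge0 ?ler_pM// ltW.
Qed.

(** [phi 1%:M] is the same quotient with the standard norm for [zn z]. Each of the two norms loses
    [q^(2m)] by [vnorm_zn] or [q^m] by [zn_le]. *)
Lemma zn_phi m z x y : U_ m z -> wedge x y != 0 ->
  abs (wedge x y) / (zn z x * zn z y) <= q ^+ (4 * m) * phi 1%:M x y /\
  phi 1%:M x y <= q ^+ (2 * m) * (abs (wedge x y) / (zn z x * zn z y)).
Proof.
move=> hU xy; have [x0 y0] := wedge_neq0 xy; have hz : Omega z by case: hU.
have zx := zn_gt0 hz x0; have zy := zn_gt0 hz y0.
have vx := vnorm_gt0 R x0; have vy := vnorm_gt0 R y0.
have W0 : 0 < abs (wedge x y) by rewrite laurent_abs_gt0.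
have q0 k := exprn_gt0 k (q_gt0 R Fq).
have -> : phi 1%:M x y = abs (wedge x y) / (vnorm R x * vnorm R y).
  by rewrite phi.unlock !lnorm.unlock invmx1 !mulmx1 det1 laurent_abs1 mul1r.
have [-> ->] : (4 * m = (m + m) * 2)%N /\ (2 * m = m * 2)%N by lia.
by rewrite !exprM; split; apply: ratio_le; rewrite ?(ltW W0) ?vnorm_zn ?zn_le.
Qed.

End HalfPlaneBounds.

(** * Ultrametric series and rational functions on Omega *)

Section Series.
Variables (R : realType) (Fq : finFieldType) (CC : Cinfty R Fq).
Local Notation F := (laurent Fq).
Local Notation C := (Cinf CC).
Local Notation q := (#|Fq|%:R : R).
Local Notation FC := (F_to_C CC).
Implicit Types (z w : C) (f g : C -> C).

Lemma Cabs_sum_lt (I : eqType) (r : seq I) (P : pred I) (t : I -> C) (e : R) :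
  0 < e -> (forall i, i \in r -> P i -> Cabs (t i) < e) ->
  Cabs (\sum_(i <- r | P i) t i) < e.
Proof.
move=> e0 ht; rewrite big_seq_cond.
elim/big_ind: _ => [|z w|i /andP[]]; [by rewrite Cabs0|exact: CabsD_lt|exact: ht].
Qed.

Lemma Cabs_sum_le (I : Type) (r : seq I) (t : I -> C) (e : R) :
  0 <= e -> (forall i, Cabs (t i) <= e) -> Cabs (\sum_(i <- r) t i) <= e.
Proof.
move=> e0 ht; elim/big_ind: _ => [|z w|i _]; [by rewrite Cabs0|exact: CabsD_le|exact: ht].
Qed.

(** The common terms cancel, leaving the symmetric difference. *)
Lemma fset_sum_sub_lt (I : choiceType) (A B : {fset I}) (t : I -> C) (e : R) : 0 < e ->
  (forall i, i \in A -> i \notin B -> Cabs (t i) < e) ->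
  (forall i, i \in B -> i \notin A -> Cabs (t i) < e) ->
  Cabs (\sum_(i <- A) t i - \sum_(i <- B) t i) < e.
Proof.
move=> e0 hA hB; rewrite (bigID (fun i => i \in B)) /=.
rewrite [X in _ - X](bigID (fun i => i \in A)) /=.
have -> : \sum_(i <- A | i \in B) t i = \sum_(i <- B | i \in A) t i.
  rewrite -big_filter -[RHS]big_filter; apply: perm_big; apply: uniq_perm.
  - by rewrite filter_uniq.
  - by rewrite filter_uniq.
  - by move=> i; rewrite !mem_filter andbC.
rewrite opprD addrACA subrr add0r; apply: CabsB_lt; exact: Cabs_sum_lt.
Qed.

Definition seq_cvg_to (w : nat -> C) (l : C) :=
  forall e : R, 0 < e -> exists N, forall n, (N <= n)%N -> Cabs (w n - l) < e.

(** A tail is no larger than its largest term, so the smallness of the terms alone decides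
    convergence. *)
Lemma loc_unif_sumP (I : choiceType) (t : I -> C -> C) :
  (exists f, loc_unif_sum t f) <->
  forall m (e : R), 0 < e -> finite_set [set i | exists2 z, U_ m z & e <= Cabs (t i z)].
Proof.
split=> [[f hf] m e e0|h].
  have [A0 hA] := hf m e e0; apply: (finite_subfset A0) => i [z hz ti] /=.
  apply/negPn/negP => iA; move: ti; rewrite leNgt => /negP; apply.
  (* One more index changes the sum by its own term, while both sums are within [e] of [f z]. *)
  have -> : t i z = (\sum_(j <- (i |` A0)%fset) t j z - f z) -
                    (\sum_(j <- A0) t j z - f z).
    by rewrite big_fsetU1//= opprB addrA subrK addrK.
  by apply: CabsB_lt; apply: hA => //; apply: fsubsetU1.
have q0 := q_gt0 R Fq; have qn n : 0 < q ^- n by rewrite invr_gt0 exprn_gt0.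
have qle (m n : nat) : (m <= n)%N -> q ^- n <= q ^- m.
  by move=> mn; rewrite lef_pV2 ?posrE ?exprn_gt0// ler_eXn2l ?q_gt1.
(* One sequence of finite sets exhausts Omega and refines the precision at the same time. *)
pose A (n : nat) := fset_set [set i | exists2 z, U_ n z & q ^- n <= Cabs (t i z)].
have tA n i z : i \notin A n -> U_ n z -> Cabs (t i z) < q ^- n.
  rewrite in_fset_set; last exact: h.
  by rewrite notin_setE /= => hi hz; rewrite ltNge; apply/negP => ?; apply: hi; exists z.
pose S (n : nat) z := \sum_(i <- A n) t i z.
have SS N n (B : {fset I}) z : (N <= n)%N -> U_ N z ->
    (forall i, i \notin B -> Cabs (t i z) < q ^- N) ->
    Cabs (\sum_(i <- B) t i z - S n z) < q ^- N.
  move=> Nn hz hB; apply: fset_sum_sub_lt => // i hi1 hi2; last exact: hB.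
  apply: lt_le_trans (qle _ _ Nn); apply: tA => //.
  exact: U_mono hz.
have small (e : R) : 0 < e -> exists n : nat, q ^- n < e.
  move=> e0; have [n hn] := expq_unbounded Fq e^-1; exists n.
  by rewrite -[e]invrK ltf_pV2 ?posrE ?invr_gt0// exprn_gt0.
have SC n0 n1 N z : (N <= n0)%N -> (N <= n1)%N -> U_ N z ->
    Cabs (S n0 z - S n1 z) < q ^- N.
  move=> h0 h1 hz; apply: SS => // i hi.
  by apply: lt_le_trans (qle _ _ h0); apply: tA => //; apply: U_mono hz.
have limP m z : U_ m z -> exists l, seq_cvg_to (S^~ z) l.
  move=> hz; apply: Cinf_complete => e /small[n hn].
  exists (maxn m n) => n0 n1 hn0 hn1; apply: lt_trans hn.
  apply: lt_le_trans (qle _ _ (leq_maxr m n)).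
  by apply: SC => //; apply: U_mono hz; apply: leq_maxl.
(* A pointwise limit; the default [0] never occurs on a [U_ m], by [limP]. *)
exists (fun z => xget 0 [set l | seq_cvg_to (S^~ z) l]) => m e e0.
have [n hn] := small _ e0; pose N := maxn m n; exists (A N) => B AB z hz.
have hzN : U_ N z by apply: U_mono hz; apply: leq_maxl.
have hNe : q ^- N < e by apply: le_lt_trans hn; apply/qle/leq_maxr.
case: xgetP => [l _ hl|/=]; last by have [l hl] := limP m z hz; move=> /(_ l).
(* [K] depends on [z], but the other difference is below [q ^- N] for every later partial sum, so
   the bound stays uniform. *)
have [K hK] := hl _ e0.
have -> : \sum_(i <- B) t i z - l =
    (\sum_(i <- B) t i z - S (maxn N K) z) + (S (maxn N K) z - l).
  by rewrite addrA subrK.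
apply: CabsD_lt; last by apply/hK/leq_maxr.
apply: lt_trans hNe; apply: SS => //; first exact: leq_maxl.
move=> i iB; apply: tA => //; apply: contraNN iB.
exact: (fsubsetP AB).
Qed.

Definition rat_on_Omega f := exists p d : {poly C},
  forall z, Omega z -> d.[z] != 0 /\ f z = p.[z] / d.[z].

Lemma rat_on_Omega_cst (c : C) : rat_on_Omega (fun=> c).
Proof. by exists c%:P, 1 => z _; rewrite !hornerE oner_eq0 divr1. Qed.

Lemma rat_on_OmegaD f g : rat_on_Omega f -> rat_on_Omega g ->
  rat_on_Omega (fun z => f z + g z).
Proof.
move=> [p [d h]] [p' [d' h']]; exists (p * d' + p' * d), (d * d') => z hz.
have [d0 ->] := h z hz; have [d0' ->] := h' z hz.
by rewrite !hornerE mulf_neq0//; split=> //; field; rewrite d0 d0'.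
Qed.

Lemma rat_on_OmegaM f g : rat_on_Omega f -> rat_on_Omega g ->
  rat_on_Omega (fun z => f z * g z).
Proof.
move=> [p [d h]] [p' [d' h']]; exists (p * p'), (d * d') => z hz.
have [d0 ->] := h z hz; have [d0' ->] := h' z hz.
by rewrite !hornerM mulf_neq0// mulf_div.
Qed.

Lemma rat_on_OmegaX f n : rat_on_Omega f -> rat_on_Omega (fun z => f z ^+ n).
Proof.
move=> hf; elim: n => [|n IH]; first exact: rat_on_Omega_cst.
have [p [d h]] := rat_on_OmegaM hf IH; exists p, d => z hz.
by have [? e] := h z hz; rewrite exprS e.
Qed.

Lemma rat_on_Omega_sum (I : Type) (r : seq I) (t : I -> C -> C) :
  (forall i, rat_on_Omega (t i)) -> rat_on_Omega (fun z => \sum_(i <- r) t i z).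
Proof.
move=> ht; elim: r => [|i r IH].
  have [p [d h]] := rat_on_Omega_cst 0; exists p, d => z hz.
  by have [? e] := h z hz; rewrite big_nil.
have [p [d h]] := rat_on_OmegaD (ht i) IH; exists p, d => z hz.
by have [? e] := h z hz; rewrite big_cons.
Qed.

Lemma rat_on_Omega_prod (I : Type) (r : seq I) (t : I -> C -> C) :
  (forall i, rat_on_Omega (t i)) -> rat_on_Omega (fun z => \prod_(i <- r) t i z).
Proof.
move=> ht; elim: r => [|i r IH].
  have [p [d h]] := rat_on_Omega_cst 1; exists p, d => z hz.
  by have [? e] := h z hz; rewrite big_nil.
have [p [d h]] := rat_on_OmegaM (ht i) IH; exists p, d => z hz.
by have [? e] := h z hz; rewrite big_cons.
Qed.

Lemma rat_on_Omega_inv_sub a : rat_on_Omega (fun z => inv_sub z a).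
Proof.
case: a => [t|]; last exact: rat_on_Omega_cst.
exists 1, ('X - (FC t)%:P) => z hz /=; rewrite !hornerE.
by rewrite Omega_sub// mul1r.
Qed.

Lemma rat_on_Omega_u a b : rat_on_Omega (fun z => u_ z a b).
Proof.
have [p [d h]] := rat_on_OmegaD (rat_on_Omega_inv_sub b)
  (rat_on_OmegaM (rat_on_Omega_cst (-1)) (rat_on_Omega_inv_sub a)).
by exists p, d => z hz; have [? e] := h z hz; rewrite /u_ -mulN1r e.
Qed.

(** A finite partial sum is itself the rational approximation required on [U_ m]. *)
Lemma loc_unif_sum_holomorphic (I : choiceType) (t : I -> C -> C) f :
  (forall i, rat_on_Omega (t i)) -> loc_unif_sum t f -> holomorphic f.
Proof.
move=> ht hf m e e0; have [A hA] := hf m e e0.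
have [p [d h]] := rat_on_Omega_sum (enum_fset A) ht; exists p, d => z hz.
have [d0 <-] := h z (let: And3 hz _ _ := hz in hz); split=> //.
by rewrite Cabs_subC; apply: hA.
Qed.

(** With [B] itself as tolerance, the ultrametric inequality loses nothing between a partial sum and
    [f z]. *)
Lemma loc_unif_sum_le (I : choiceType) (t : I -> C -> C) f z (B : R) :
  loc_unif_sum t f -> Omega z -> 0 < B -> (forall i, Cabs (t i z) <= B) -> Cabs (f z) <= B.
Proof.
move=> hf /Omega_U[m hz] B0 hB; have [A hA] := hf m B B0.
have -> : f z = \sum_(i <- A) t i z - (\sum_(i <- A) t i z - f z).
  by rewrite opprB addrC subrK.
apply: CabsD_le; first by apply: Cabs_sum_le => //; apply: ltW.
by rewrite CabsN ltW// hA.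
Qed.

End Series.

(** * Scaling, group action and change of lattice in [phi] *)

Section PhiComparison.
Variables (R : realType) (Fq : finFieldType).
Local Notation F := (laurent Fq).
Local Notation q := (#|Fq|%:R : R).
Local Notation abs := (@laurent_abs Fq R).
Local Notation lnorm := (@lnorm R Fq).
Local Notation phi := (@phi R Fq).
Implicit Types (x y : 'rV[F]_2) (g h : 'M[F]_2).

Lemma phiZ g (c d : F) x y : c != 0 -> d != 0 -> phi g (c *: x) (d *: y) = phi g x y.
Proof.
move=> c0 d0; rewrite phi.unlock wedgeZl wedgeZr !lnormZ !laurent_absM.
move: c0 d0; rewrite -!(laurent_abs_eq0 R); move: (abs c) (abs d) => c' d' c0 d0.
(* A vanishing denominator makes both sides 0, by the convention for the inverse of 0. *)
have [->|e1] := eqVneq (abs (\det g)) 0; first by rewrite !mul0r invr0 !mulr0.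
have [->|e2] := eqVneq (lnorm g x) 0; first by rewrite !(mulr0, mul0r) invr0 !mulr0.
have [->|e3] := eqVneq (lnorm g y) 0; first by rewrite !mulr0 invr0 !mulr0.
by field; rewrite e1 e2 e3 c0 d0.
Qed.

Lemma phi_act g h x y : g \in unitmx -> h \in unitmx ->
  phi (h *m invmx g) x y = phi h (x *m g) (y *m g).
Proof.
move=> gu hu; rewrite phi.unlock !lnorm_act// wedgeM abs_det_div laurent_absM.
by rewrite !invfM invrK; ring.
Qed.

(** Moving the vertex changes all distances to apartments by a bounded amount. With
    [lnorm h <= E * lnorm g], the two norms cost [E * E] and the covolumes their ratio; [q^M]
    exceeds the product. *)
Lemma phi_le g h : g \in unitmx -> h \in unitmx -> exists M : nat,
  forall x y, wedge x y != 0 -> phi g x y <= q ^+ M * phi h x y.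
Proof.
move=> gu hu; pose E := \sum_(p : 'I_2 * 'I_2) abs ((g *m invmx h) p.1 p.2).
have hE i j : abs ((g *m invmx h) i j) <= E.
  rewrite /E (bigD1 (i, j))//= lerDl sumr_ge0// => p _; exact: laurent_abs_ge0.
have [M hM] := expq_unbounded Fq (E * E * (abs (\det h) / abs (\det g))).
exists M => x y xy; have [x0 y0] := wedge_neq0 xy.
have hN z : lnorm h z <= E * lnorm g z.
  rewrite lnorm.unlock -{1}(mulmxKV gu z) -[X in vnorm _ X <= _]mulmxA mulrC.
  exact: vnorm_mulmx.
have [gx gy] := (lnorm_gt0 R gu x0, lnorm_gt0 R gu y0).
have [hx hy] := (lnorm_gt0 R hu x0, lnorm_gt0 R hu y0).
have [dg dh] := (abs_det_gt0 R gu, abs_det_gt0 R hu).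
have W0 : 0 < abs (wedge x y) by rewrite laurent_abs_gt0.
have p0 : 0 < phi h x y by rewrite phi.unlock !divr_gt0 ?mulr_gt0.
apply: le_trans (ler_wpM2r (ltW p0) (ltW hM)); rewrite phi.unlock.
move: (hN x) (hN y) gx gy hx hy dg dh W0.
move: (lnorm g x) (lnorm g y) (lnorm h x) (lnorm h y) (abs (\det g)) (abs (\det h)).
move: (abs (wedge x y)) => W gx gy hx hy dg dh h1 h2 gx0 gy0 hx0 hy0 dg0 dh0 W0.
rewrite ler_pdivrMr ?mulr_gt0//.
have -> : E * E * (dh / dg) * (W / (dh * hx * hy)) * (dg * gx * gy) =
    W / (hx * hy) * ((E * gx) * (E * gy)) by field; rewrite !gt_eqF.
by rewrite mulrAC ler_pdivlMr ?mulr_gt0// ler_pM2l// ler_pM ?(ltW hx0) ?(ltW hy0).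
Qed.

End PhiComparison.

(** * Coset representatives *)

Section Cosets.
Variables (Fq : finFieldType) (G H : set 'M[laurent Fq]_2).
Hypotheses (H_grp : GL2_subgroup H).
Hypotheses (G_grp : GL2_subgroup G) (HG : H `<=` G).

Lemma coset_mul h g : H h -> coset H (h *m g) = coset H g.
Proof.
case: H_grp => Hu H1 HM HV hh; apply/seteqP; split=> _ [x hx <-].
  by exists (x *m h); [exact: HM | rewrite mulmxA].
exists (x *m invmx h); first by apply: HM => //; apply: HV.
by rewrite mulmxA (mulmxKV (Hu h hh)).
Qed.

Lemma coset_reprP (X : cosets H G) g : val X = coset H g ->
  exists2 h, H h & coset_repr X = h *m g.
Proof.
move=> Xg; rewrite /coset_repr Xg.
case: xgetP => [_ _ [h hh <-]|/(_ g)]; first by exists h.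
by case: H_grp => _ H1 _ _ []; exists 1%:M => //; rewrite mul1mx.
Qed.

Lemma coset_repr_in (X : cosets H G) :
  G (coset_repr X) /\ val X = coset H (coset_repr X).
Proof.
have [g Gg Xg] : cosets H G (val X) by apply/set_mem/valP.
have [h hh e] := coset_reprP (esym Xg); rewrite e coset_mul//; split=> //.
by case: G_grp => _ _ GM _; apply: GM => //; apply: HG.
Qed.

End Cosets.

(** * Bounds for the terms of the series *)

Section Terms.
Variables (R : realType) (Fq : finFieldType) (CC : Cinfty R Fq).
Variables (r : nat) (k : 'I_r -> nat) (l : int) (a b : 'I_r -> option (laurent Fq)).
Hypothesis ab_neq : forall i, a i <> b i.
Local Notation F := (laurent Fq).
Local Notation C := (Cinf CC).
Local Notation q := (#|Fq|%:R : R).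
Local Notation abs := (@laurent_abs Fq R).
Local Notation phi := (@phi R Fq).
Local Notation ksum := (\sum_(i < r) k i)%N.
Implicit Types (g h : 'M[F]_2) (z : C).

(* [q ^- d] for [d] the distance from the vertex of [h] to [g^-1 [a_i -> b_i]]. *)
Definition orbit_phi h g i := phi h (ptv (a i) *m g) (ptv (b i) *m g).

Lemma wedge_ptv_mul g i : g \in unitmx ->
  wedge (ptv (a i) *m g) (ptv (b i) *m g) != 0.
Proof. by move=> gu; rewrite wedgeM mulf_neq0 ?det_neq0 ?ptv_wedge. Qed.

Lemma S_setE G H N h : GL2_subgroup G -> h \in unitmx ->
  S_ R G H a b N (vmx h) =
  [set coset H g | g in [set g | G g /\ forall i, q ^- N <= orbit_phi h g i]].
Proof.
move=> [Gu _ _ _] hu; rewrite /S_; congr image; apply/seteqP; split=> g [Gg hg];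
  split=> // i; have gu := Gu g Gg.
  rewrite /orbit_phi -phi_act//; apply/tree_dist_set_geodesic => //.
    by rewrite unitmx_mul hu unitmx_inv.
  by rewrite -vertex_act_vmx.
rewrite vertex_act_vmx; apply/tree_dist_set_geodesic => //.
  by rewrite unitmx_mul hu unitmx_inv.
by rewrite phi_act//; apply: hg.
Qed.

Lemma finite_S_indep G H h h' : GL2_subgroup G -> h \in unitmx -> h' \in unitmx ->
  (forall N, finite_set (S_ R G H a b N (vmx h))) ->
  forall N, finite_set (S_ R G H a b N (vmx h')).
Proof.
move=> Ggrp hu hu' fin N; have [M hM] := phi_le R hu' hu.
apply: sub_finite_set (fin (N + M)%N); rewrite !S_setE//.
apply: image_subset => g [Gg hg]; split=> // i; have [Gu _ _ _] := Ggrp.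
have w := wedge_ptv_mul i (Gu g Gg).
rewrite exprD invfM ler_pdivrMr ?exprn_gt0 ?q_gt0// mulrC.
exact: le_trans (hg i) (hM _ _ w).
Qed.

(** Fixing both points, [h0] only rescales their row vectors. Hence the chosen coset representative
    does not matter. *)
Lemma orbit_phi_mul h h0 g i : h0 \in unitmx ->
  mobius h0 (a i) = a i -> mobius h0 (b i) = b i ->
  orbit_phi h (h0 *m g) i = orbit_phi h g i.
Proof.
move=> h0u ha hb; have [c c0] := ptv_mobius (a i) h0u.
have [d d0] := ptv_mobius (b i) h0u.
by rewrite ha hb /orbit_phi !mulmxA => -> ->; rewrite -!scalemxAl phiZ.
Qed.

Lemma Cabs_term g z : Oinf_units (\det g) ->
  Cabs (term k l a b g z) = \prod_(i < r)
    Cabs (u_ z (mobius (invmx g) (a i)) (mobius (invmx g) (b i))) ^+ k i.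
Proof.
case=> d0 /(OinfP R) d1 /(OinfP R); rewrite laurent_absV => d2.
have dg : abs (\det g) = 1.
  apply/eqP; rewrite eq_le d1 /= -[abs _]invrK invf_ge1// invr_gt0.
  by rewrite laurent_abs_gt0.
rewrite /term CabsM Cabs_FC laurent_absX dg exp1rz mul1r Cabs_prod.
by apply: eq_bigr => i _; rewrite CabsX.
Qed.

Lemma Cabs_u_mobius g z i : Omega z -> g \in unitmx ->
  Cabs (u_ z (mobius (invmx g) (a i)) (mobius (invmx g) (b i))) =
  abs (wedge (ptv (a i) *m g) (ptv (b i) *m g)) /
    (zn z (ptv (a i) *m g) * zn z (ptv (b i) *m g)).
Proof.
move=> hz gu; rewrite Cabs_u//.
have [c c0 ->] := ptv_mobius_inv (a i) gu; have [d d0 ->] := ptv_mobius_inv (b i) gu.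
have w := wedge_ptv_mul i gu; have [x0 y0] := wedge_neq0 w.
have := zn_gt0 hz x0; have := zn_gt0 hz y0.
rewrite wedgeZl wedgeZr !znZ !laurent_absM; move: c0 d0; rewrite -!(laurent_abs_eq0 R).
move: (abs c) (abs d) (zn z _) (zn z _) (abs _) => A B X Y W A0 B0 Y0 X0.
by field; rewrite A0 B0 !gt_eqF.
Qed.

Lemma Cabs_term_le g z : Oinf_units (\det g) -> Omega z ->
  Cabs (term k l a b g z) <= imabs z ^- ksum.
Proof.
move=> dg hz; rewrite Cabs_term// -exprVn -prodrXr.
apply: ler_prod => i _; rewrite exprn_ge0 ?Cabs_ge0//=.
by rewrite lerXn2r ?nnegrE ?Cabs_ge0 ?invr_ge0 ?imabs_ge0 ?Cabs_u_le.
Qed.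

(** Each of the [ksum] factors is at least [q^-(2m + N)], the [2m] being the loss in [zn_phi]. *)
Lemma Cabs_term_ge m N g z : g \in unitmx -> Oinf_units (\det g) -> U_ m z ->
  (forall i, q ^- N <= orbit_phi 1%:M g i) ->
  q ^- ((2 * m + N) * ksum) <= Cabs (term k l a b g z).
Proof.
move=> gu dg hz hQ; have hz' : Omega z by case: hz.
have q0 n := exprn_gt0 n (q_gt0 R Fq).
rewrite Cabs_term// exprM -exprVn -prodrXr.
apply: ler_prod => i _; rewrite exprn_ge0 ?invr_ge0 ?(ltW (q0 _))//=.
rewrite lerXn2r ?nnegrE ?Cabs_ge0 ?invr_ge0 ?(ltW (q0 _))//.
rewrite Cabs_u_mobius// exprD invfM mulrC ler_pdivrMr// mulrC.
exact: le_trans (hQ i) (zn_phi hz (wedge_ptv_mul i gu)).2.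
Qed.

(** As [k i] is positive, one copy of the small [i]-th factor can be split off; the remaining
    factors are at most [q^m] each, and [m * ksum] generously counts them all. *)
Lemma Cabs_term_lt m N g z i : (0 < k i)%N -> g \in unitmx -> Oinf_units (\det g) ->
  U_ m z -> orbit_phi 1%:M g i < q ^- N ->
  Cabs (term k l a b g z) < q ^+ (4 * m + m * ksum) * q ^- N.
Proof.
move=> ki gu dg hz hQ; have hz' : Omega z by case: hz.
have q0 n := exprn_gt0 n (q_gt0 R Fq); have q1 := ltW (q_gt1 R Fq).
have hU j : Cabs (u_ z (mobius (invmx g) (a j)) (mobius (invmx g) (b j))) <= q ^+ m.
  apply: le_trans (Cabs_u_le _ _ hz') _; rewrite invf_ple ?posrE ?imabs_gt0//.
  by case: hz.
have hi : Cabs (u_ z (mobius (invmx g) (a i)) (mobius (invmx g) (b i))) <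
    q ^+ (4 * m) * q ^- N.
  rewrite Cabs_u_mobius//; apply: le_lt_trans (zn_phi hz (wedge_ptv_mul i gu)).1 _.
  by rewrite ltr_pM2l.
have rest : Cabs (u_ z (mobius (invmx g) (a i)) (mobius (invmx g) (b i))) ^+ (k i).-1 *
    \prod_(j | j != i) Cabs (u_ z (mobius (invmx g) (a j)) (mobius (invmx g) (b j))) ^+ k j
    <= q ^+ (m * ksum).
  rewrite exprM -prodrXr [X in _ <= X](bigD1 i)//=.
  apply: ler_pM; rewrite ?exprn_ge0 ?Cabs_ge0 ?prodr_ge0//.
  - by move=> j _; rewrite exprn_ge0 ?Cabs_ge0.
  - apply: (@le_trans _ _ ((q ^+ m) ^+ (k i).-1)).
      by rewrite lerXn2r ?nnegrE ?Cabs_ge0 ?(ltW (q0 _)).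
    by rewrite ler_weXn2l ?exprn_ege1// leq_pred.
  - apply: ler_prod => j _; rewrite exprn_ge0 ?Cabs_ge0//=.
    by rewrite lerXn2r ?nnegrE ?Cabs_ge0 ?(ltW (q0 _)).
rewrite Cabs_term// (bigD1 i)//= -{1}(prednK ki) exprS -mulrA.
apply: le_lt_trans (ler_wpM2l (Cabs_ge0 _) rest) _.
by rewrite exprD mulrAC ltr_pM2r.
Qed.

Lemma rat_on_Omega_term g : rat_on_Omega (term (CC := CC) k l a b g).
Proof.
apply: rat_on_OmegaM; first exact: rat_on_Omega_cst.
by apply: rat_on_Omega_prod => i; apply: rat_on_OmegaX; apply: rat_on_Omega_u.
Qed.

End Terms.


(** * The convergence criterion and the theorem *)

Section Main.
Variables (R : realType) (Fq : finFieldType) (CC : Cinfty R Fq).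
Variables (G H : set 'M[laurent Fq]_2).
Hypotheses (G_grp : GL2_subgroup G) (G_det : forall g, G g -> Oinf_units (\det g)).
Hypotheses (H_grp : GL2_subgroup H) (HG : H `<=` G).
Variables (r : nat) (k : 'I_r -> nat) (l : int) (a b : 'I_r -> option (laurent Fq)).
Hypothesis k_gt0 : forall i, (0 < k i)%N.
Hypothesis ab_neq : forall i, a i <> b i.
Hypothesis ab_fixed : forall h, H h -> forall i,
  mobius h (a i) = a i /\ mobius h (b i) = b i.
Local Notation C := (Cinf CC).
Local Notation q := (#|Fq|%:R : R).
Local Notation ksum := (\sum_(i < r) k i)%N.
Local Notation t := (coset_term (CC := CC) (G := G) (H := H) k l a b).

Let G_unit g : G g -> g \in unitmx. Proof. by case: G_grp => + _ _ _; apply. Qed.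

(** At a single point of Omega all cosets in [S_N] have terms above one fixed positive bound. *)
Lemma coset_term_cvg_finite : (exists f, loc_unif_sum t f) ->
  forall N, finite_set (S_ R G H a b N (vmx 1%:M)).
Proof.
move=> /loc_unif_sumP fin N; have [z /Omega_U[m hz]] := Omega_nonempty CC.
have e0 : 0 < q ^- ((2 * m + N) * ksum) by rewrite invr_gt0 exprn_gt0 ?q_gt0.
apply: sub_finite_set (finite_image val (fin m _ e0)).
rewrite S_setE ?unitmx1// => _ [g [Gg hg] <-].
have gX : cosets H G (coset H g) by exists g.
exists (SigSub (mem_set gX)) => //; exists z => //.
have [h hh e] := coset_reprP H_grp (erefl (val (SigSub (mem_set gX)))).
rewrite /coset_term e.
have Ghg : G (h *m g) by case: G_grp => _ _ GM _; apply: GM => //; apply: HG.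
apply: Cabs_term_ge => // [||i]; [exact: G_unit|exact: G_det|].
have [ha hb] := ab_fixed hh i.
by rewrite orbit_phi_mul//; apply/G_unit/HG.
Qed.

Lemma finite_coset_term_cvg : (forall N, finite_set (S_ R G H a b N (vmx 1%:M))) ->
  exists f, loc_unif_sum t f.
Proof.
move=> fin; apply/loc_unif_sumP => m e e0.
have q0 n := exprn_gt0 n (q_gt0 R Fq).
(* For this [N], the bound of [Cabs_term_lt] on cosets outside [S_N] drops below [e]. *)
have [N hN] := expq_unbounded Fq (q ^+ (4 * m + m * ksum) / e).
pose v (X : cosets H G) : set 'M[laurent Fq]_2 := val X.
have vfin : finite_set (v @^-1` S_ R G H a b N (vmx 1%:M)).
  by apply: finite_preimage (fin N) => X Y _ _; apply: val_inj.
apply: sub_finite_set vfin => X [z hz hX]; rewrite /v /=.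
have [GX XE] := coset_repr_in H_grp G_grp HG X.
rewrite S_setE ?unitmx1//; exists (coset_repr X) => //; split=> // i.
rewrite leNgt; apply/negP => hQ; move: hX; rewrite leNgt => /negP; apply.
apply: lt_trans (Cabs_term_lt l ab_neq (k_gt0 i) (G_unit GX) (G_det GX) hz hQ) _.
by rewrite ltr_pdivrMr// mulrC -ltr_pdivrMr.
Qed.

End Main.

Theorem theorem3p1p3 (R : realType) (Fq : finFieldType) (q_odd : odd #|Fq|)
  (CC : Cinfty R Fq) (Gamma : set 'M[laurent Fq]_2)
  (Gamma_grp : GL2_subgroup Gamma) (Gamma_discrete : GL2_discrete R Gamma)
  (Gamma_det : forall g, Gamma g -> Oinf_units (\det g))
  (r : nat) (r_ge1 : (1 <= r)%N)
  (k : 'I_r -> nat) (k_ge1 : forall i, (1 <= k i)%N) (l : int)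
  (H : set 'M[laurent Fq]_2) (H_grp : GL2_subgroup H) (H_sub : H `<=` Gamma)
  (H_det : forall h, H h -> \det h ^ l = 1)
  (a b : 'I_r -> option (laurent Fq))
  (ab_neq : forall i, a i <> b i)
  (ab_pairs : forall i j, i <> j -> [set a i; b i] <> [set a j; b j])
  (ab_fixed : forall h, H h -> forall i,
    mobius h (a i) = a i /\ mobius h (b i) = b i) :
  let ksum := (\sum_(i < r) k i)%N in
  let t := coset_term (CC := CC) (G := Gamma) (H := H) k l a b in
  let finite_S v := forall N, finite_set (S_ R Gamma H a b N v) in
  [/\ (exists f : CC -> CC, loc_unif_sum t f) <-> (exists2 v, vertex v & finite_S v),
      (exists2 v, vertex v & finite_S v) <-> (forall v, vertex v -> finite_S v)
    & forall f : CC -> CC, loc_unif_sum t f ->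
      [/\ holomorphic f,
          holomorphic_form ksum (fun z v => f z * dz_pow ksum v)
        & forall z : CC, Omega z -> Cabs (f z) <= imabs z ^- ksum]].
Proof.
move=> ksum t finite_S.
have u1 : (1%:M : 'M[laurent Fq]_2) \in unitmx by rewrite unitmx1.
have all_S : (exists2 v, vertex v & finite_S v) -> forall v, vertex v -> finite_S v.
  case=> _ /vertexP[g gu ->] fin _ /vertexP[h hu ->].
  exact (finite_S_indep ab_neq Gamma_grp gu hu fin).
split.
- split=> [cv|/all_S fin].
    exists (vmx 1%:M); first exact: vmx_vertex.
    exact (coset_term_cvg_finite Gamma_grp Gamma_det H_grp H_sub ab_neq ab_fixed cv).
  exact (finite_coset_term_cvg CC Gamma_grp Gamma_det H_grp H_sub l k_ge1 ab_neq
    (fin _ (vmx_vertex u1))).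
- by split=> // fin; exists (vmx 1%:M); [|apply: fin]; apply: vmx_vertex.
move=> f cv; have hol : holomorphic f.
  by apply: loc_unif_sum_holomorphic cv => X; apply: rat_on_Omega_term.
split=> //; first by exists f.
move=> z hz; have B0 : 0 < imabs z ^- ksum by rewrite invr_gt0 exprn_gt0 ?imabs_gt0.
apply: (loc_unif_sum_le cv hz B0) => X.
have [GX _] := coset_repr_in H_grp Gamma_grp H_sub X.
exact: Cabs_term_le (Gamma_det _ GX) hz.
Qed.
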